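(* Let $\mathbf n_\kappa=(n_\kappa(i))_{i\ge 0}$, $\kappa\ge 1$, be degree statistics such that, as $\kappa\to\infty$, $|\mathbf n_\kappa|\to\infty$ and $n_\kappa(i)/|\mathbf n_\kappa|\to p_i$ for every $i\ge 0$, where $\mathbf p=(p_i)_{i\ge0}$ is a probability distribution on $\mathbb N_0$. Let $\mathcal T_{\mathbf n_\kappa}\sim\mathrm{Unif}(\mathbb T_{\mathbf n_\kappa})$. Suppose that $f:\mathbb T\to\mathbb R$ is a functional of rooted trees with finite support, i.e. $f(T)\ne0$ for only finitely many $T\in\mathbb T$, and let $F$ be the corresponding additive functional, $F(T):=\sum_{v\in T}f(T_v)$. Then, as $\kappa\to\infty$, $$\mathbb E F(\mathcal T_{\mathbf n_\kappa})=|\mathbf n_\kappa|\,\mathbb E_{\pi_{\mathbf p}}[f(\mathcal T)]+o(|\mathbf n_\kappa|),$$ $$\mathrm{Var}\,F(\mathcal T_{\mathbf n_\kappa})=|\mathbf n_\kappa|\,\gamma_{\mathbf p}(f)+o(|\mathbf n_\kappa|),$$ where $$\gamma_{\mathbf p}(f):=2\mathbb E_{\pi_{\mathbf p}}[f(\mathcal T)F(\mathcal T)]-\mathbb E_{\pi_{\mathbf p}}[f(\mathcal T)^2]+\bigl(\mathbb E_{\pi_{\mathbf p}}[f(\mathcal T)(|\mathcal T|-1)]\bigr)^2-\sum_{i\ge0}\frac1{p_i}\bigl(\mathbb E_{\pi_{\mathbf p}}[f(\mathcal T)n_{\mathcal T}(i)]\bigr)^2\mathbf 1_{\{p_i>0\}}$$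 is finite, with $0\le\gamma_{\mathbf p}(f)<\infty$. Furthermore, $$\frac{F(\mathcal T_{\mathbf n_\kappa})-\mathbb E[F(\mathcal T_{\mathbf n_\kappa})]}{\sqrt{|\mathbf n_\kappa|}}\to\mathrm N(0,\gamma_{\mathbf p}(f))\quad\text{in distribution, as }\kappa\to\infty.$$
   Context: $\mathbb N_0=\{0,1,2,\dots\}$. $\mathbb T$ is the set of all finite plane (i.e. ordered) rooted trees, up to isomorphism. For $T\in\mathbb T$, $|T|$ is its number of vertices and $n_T(i)$ is the number of vertices of $T$ with exactly $i$ children. A degree statistic is a sequence $\mathbf n=(n(i))_{i\ge0}$ of non-negative integers with $\sum_{i\ge0}n(i)=1+\sum_{i\ge0}i\,n(i)<\infty$; $|\mathbf n|:=\sum_{i\ge0}n(i)$; $\mathbb T_{\mathbf n}$ is the set of $T\in\mathbb T$ with $n_T(i)=n(i)$ for all $i$; $\mathrm{Unif}(\mathbb T_{\mathbf n})$ is the uniform distribution on it. For a vertex $v$ of $T$, the fringe subtree $T_v\in\mathbb T$ consists of $v$ and all its descendants, rooted at $v$. $\pi_{\mathbf p}(T):=\prod_{i\ge0}p_i^{n_T(i)}$ (with $0^0:=1$) is the probability that a Galton--Watson tree with offspring distribution $\mathbf p$ equals $T$, and $\mathbb E_{\pi_{\mathbf p}}[g(\mathcal T)]:=\sum_{T\in\mathbb T}g(T)\pi_{\mathbf p}(T)$ for $g:\mathbb T\to\mathbb R$ with $\sum_T|g(T)|\pi_{\mathbf p}(T)<\infty$. $\mathrm N(0,\gamma)$ is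 the normal distribution with mean $0$ and variance $\gamma$ (the point mass at $0$ if $\gamma=0$). Terms with $p_i=0$ in the sum over $i$ are $0$. *)

(* Defs.v *)
From HB Require Import structures.
From mathcomp Require Import all_boot all_order all_algebra.
From mathcomp Require Import finmap.
From mathcomp Require Import all_classical all_reals all_analysis.

Set Implicit Arguments.
Unset Strict Implicit.
Unset Printing Implicit Defensive.

Import Order.TTheory GRing.Theory Num.Theory.
Import numFieldNormedType.Exports.

Local Open Scope classical_set_scope.
Local Open Scope ring_scope.

(* Finite plane rooted trees: a root together with the ordered list of the
   trees hanging from it.  Leibniz equality is isomorphism of plane trees. *)
Inductive plane_tree : Type := Node of seq plane_tree.

Definition children (T : plane_tree) : seq plane_tree := let: Node s := T in s.

Fixpoint plane_tree_encode (T : plane_tree) : GenTree.tree unit :=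
  let: Node s := T in GenTree.Node 0 (map plane_tree_encode s).

Fixpoint plane_tree_decode (t : GenTree.tree unit) : plane_tree :=
  if t is GenTree.Node _ s then Node (map plane_tree_decode s) else Node [::].

Lemma plane_tree_encodeK : cancel plane_tree_encode plane_tree_decode.
Proof.
rewrite /cancel; fix IH 1; case=> s /=; congr Node.
by elim: s => //= T s ->; rewrite IH.
Qed.

HB.instance Definition _ :=
  Countable.copy plane_tree (can_type plane_tree_encodeK).
HB.instance Definition _ := isPointed.Build plane_tree (Node [::]).
HB.instance Definition _ := @isMeasurable.Build default_measure_display
  plane_tree discrete_measurable discrete_measurable0
  discrete_measurableC discrete_measurableU.

(* A vertex is given by its path from the root: the word i_1 ... i_h stands
   for the i_h-th child of ... of the i_1-th child of the root, children being
   numbered from 0. *)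
Fixpoint vertices (T : plane_tree) : seq (seq nat) :=
  let: Node s := T in
  [::] :: flatten [seq [seq iT.1 :: v | v <- iT.2]
                  | iT <- zip (iota 0 (size s)) (map vertices s)].

(* Meaningful for v \in vertices T. *)
Fixpoint fringe (T : plane_tree) (v : seq nat) : plane_tree :=
  if v is i :: v' then fringe (nth (Node [::]) (children T) i) v' else T.

Definition tree_size (T : plane_tree) : nat := size (vertices T).

Definition outdegree (T : plane_tree) (v : seq nat) : nat :=
  size (children (fringe T v)).

Definition tree_stat (T : plane_tree) (i : nat) : nat :=
  count (fun v => outdegree T v == i) (vertices T).

Definition additive_functional (R : realType) (f : plane_tree -> R)
    (T : plane_tree) : R :=
  \sum_(v <- vertices T) f (fringe T v).

Definition stat_size (n : nat -> nat) : nat :=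
  \big[addn/0%N]_(i \in [set: nat]) n i.

(* A series of natural numbers has a finite sum exactly when all but finitely
   many of its terms vanish. *)
Definition degree_statistic (n : nat -> nat) : Prop :=
  finite_set [set i | n i != 0%N] /\
  stat_size n = (1 + \big[addn/0%N]_(i \in [set: nat]) (i * n i))%N.

Definition trees_of (n : nat -> nat) : set plane_tree :=
  [set T | forall i, tree_stat T i = n i].

(* The law of X under P is uniform on D.  Taking A = setT shows that this
   forces D to be finite and nonempty. *)
Definition uniform_on d (Omega : measurableType d) (R : realType)
    (P : probability Omega R) (D : set plane_tree)
    (X : {RV P >-> plane_tree}) : Prop :=
  forall A : set plane_tree,
    distribution P X A =
    (#|` fset_set (A `&` D)|%:R / #|` fset_set D|%:R)%:E.

(* All but finitely many factors are 1. *)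
Definition gw_prob (R : realType) (p : nat -> R) (T : plane_tree) : R :=
  \big[*%R/1]_(i \in [set: nat]) p i ^+ tree_stat T i.

(* The sum of an absolutely summable family, as the difference of the sums of
   its positive and negative parts. *)
Definition gw_expect (R : realType) (p : nat -> R) (g : plane_tree -> R) :
    \bar R :=
  (\esum_(T in [set: plane_tree]) (Num.max (g T * gw_prob p T) 0)%:E
   - \esum_(T in [set: plane_tree]) (Num.max (- (g T * gw_prob p T)) 0)%:E)%E.

Definition gw_gamma (R : realType) (p : nat -> R) (f : plane_tree -> R) :
    \bar R :=
  (2%:E * gw_expect p (fun T => f T * additive_functional f T)%R
   - gw_expect p (fun T => f T ^+ 2)%R
   + gw_expect p (fun T => f T * ((tree_size T)%:R - 1))%R ^+ 2
   - \sum_(0 <= i <oo)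
       (if (0 < p i)%R
        then ((p i)^-1)%:E *
             gw_expect p (fun T => f T * (tree_stat T i)%:R)%R ^+ 2
        else 0))%E.

(* normal_prob takes the standard deviation, and is not the point mass when
   that is 0. *)
Definition centered_normal (R : realType) (gamma : R) :
    probability (measurableTypeR R) R :=
  if gamma == 0
  then (\d_(0 : measurableTypeR R) : probability (measurableTypeR R) R)
  else (normal_prob 0 (Num.sqrt gamma) : probability (measurableTypeR R) R).

Definition cvg_in_distribution (R : realType) (d : nat -> measure_display)
    (Omega : forall k, measurableType (d k))
    (P : forall k, probability (Omega k) R)
    (Y : forall k, Omega k -> R) (mu : probability (measurableTypeR R) R) :
    Prop :=
  forall g : R -> R, continuous g -> (exists M : R, forall x, `|g x| <= M) ->
    'E_(P k)[g \o Y k]%E @[k --> \oo] --> (\int[mu]_x (g x)%:E)%E.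

(* Main.v *)
Require Import Defs.
From HB Require Import structures.
From mathcomp Require Import all_boot all_order all_algebra.
From mathcomp Require Import finmap perm fingroup.
From mathcomp Require Import all_classical all_reals all_analysis.
From mathcomp Require Import measurable_realfun ring lra zify.

(** A plane tree is determined by its word, the list of the outdegrees of its
    vertices in depth-first order, and a fringe subtree is a factor of that
    word.  By the cycle lemma exactly one rotation of a cyclic arrangement of the
    outdegrees is the word of a tree.  Hence [F] of a uniform tree with given
    outdegrees has the law of a sum, over all places of a uniform cyclic
    arrangement of these outdegrees, of a function of a window of bounded length
    ([additive_functional_rot_sum], [avg_trees]).  An arrangement is a fixed
    word read through a uniform permutation of its [N] places.

    The first two moments come from exact formulas.  The probability that given
    distinct places carry a given word is that of drawing without replacement
    ([avg_occurs]).  Occurrences at disjoint places are dependent to the order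
    [1 / N] only, but there are about [N] of them for each place; the limit of
    [N] times their covariance produces the terms of the variance with [|T| - 1]
    and [1 / p i] ([cvg_draw_defect]).  Overlapping occurrences are nested and
    produce [2 f F - f^2] ([sum_pair_avg], [limit_varianceE]).

    Normality is proved by Stein's method.  Let [s] and [r] be independent
    uniform permutations and let [B] depend on the values of a permutation on a
    small set [S].  Take a permutation [t] that agrees with [r] on [S] and moves
    few points.  Then [B (t * s) = B (r * s)], and averaging gives the identity
    [Cov (B, h) = E (B (r * s) (h (t * s) - h s))] ([cov_graft]).  Applied to
    each term of the sum, and then to the local increments which this produces,
    it yields [E (W h(W)) = E (W^2) E (h'(W)) + O(N^(-1/2))] for the normalized
    sum [W] ([stein_estimate]).  For [h] a sine this is, up to a small error, the
    differential equation of the Gaussian characteristic function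
    ([avg_cos_estimate]), which the normal law satisfies exactly by integration
    by parts ([normal_cos]).

    Finally, since the second moments are bounded, a bounded continuous test
    function may be replaced by a trigonometric polynomial, obtained from a
    Bernstein polynomial in a sine, so that convergence of the characteristic
    functions is enough ([cvg_avg_bounded_continuous]). *)

Set Implicit Arguments.
Unset Strict Implicit.
Unset Printing Implicit Defensive.

Import Order.TTheory GRing.Theory Num.Theory.
Import numFieldNormedType.Exports.

Local Open Scope ring_scope.

(** * Local statistics of a uniform permutation *)
Section graft.
Variable I : finType.
Implicit Types (s : seq I) (rho tau sigma : {perm I}).
Local Open Scope group_scope.

(** A permutation that imitates [rho] on [s] while moving few points: one
    transposition for each entry of [s]. *)
Fixpoint graft s rho : {perm I} :=
  if s is a :: s' then
    let tau := graft s' rho in tau * tperm (tau a) (rho a)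
  else 1.

Lemma graftE s rho : {in s, graft s rho =1 rho}.
Proof.
elim: s => //= a s IH b; rewrite inE permM => /predU1P[-> | bs].
  by rewrite tpermL.
have [->|ba] := eqVneq b a; first by rewrite tpermL.
rewrite (IH _ bs) tpermD // ?(inj_eq (@perm_inj _ rho)) 1?eq_sym //.
by rewrite -(IH _ bs) (inj_eq (@perm_inj _ _)).
Qed.

Lemma graft_support s rho x :
  graft s rho x != x -> (x \in s) || (rho^-1 x \in s).
Proof.
elim: s x => [|a s IH] x /=; first by rewrite perm1 eqxx.
rewrite permM !inE.
have [tx|/IH/orP[->|->]] := eqVneq (graft s rho x) x; last 2 first.
- by rewrite orbT.
- by rewrite !orbT.
rewrite tx; case: tpermP => [xa _|xa _|_ _]; last by rewrite eqxx.
  suff -> : x = a by rewrite eqxx.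
  by apply: (@perm_inj _ (graft s rho)); rewrite tx.
by rewrite xa permK eqxx !orbT.
Qed.

End graft.

HB.lock Definition avg (R : realType) (T : finType) (g : T -> R) : R :=
  (\sum_x g x) / #|T|%:R.
Arguments avg {R T} g.

Section avg.
Variables (R : realType) (T : finType).
Implicit Types g h : T -> R.

Lemma avgE g : avg g = (\sum_x g x) / #|T|%:R.
Proof. by rewrite avg.unlock. Qed.

Lemma avgD g h : avg (fun x => g x + h x) = avg g + avg h.
Proof. by rewrite !avgE big_split mulrDl. Qed.

Lemma avgN g : avg (fun x => - g x) = - avg g.
Proof. by rewrite !avgE sumrN mulNr. Qed.

Lemma avgB g h : avg (fun x => g x - h x) = avg g - avg h.
Proof. by rewrite avgD avgN. Qed.

Lemma avgZ c g : avg (fun x => c * g x) = c * avg g.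
Proof. by rewrite !avgE -mulr_sumr mulrA. Qed.

Lemma avgZr c g : avg (fun x => g x * c) = avg g * c.
Proof. by rewrite !avgE -mulr_suml mulrAC. Qed.

Lemma eq_avg g h : g =1 h -> avg g = avg h.
Proof. by move=> gh; rewrite !avgE (eq_bigr _ (fun x _ => gh x)). Qed.

Lemma avg_sum (J : Type) (r : seq J) (Q : pred J) (G : J -> T -> R) :
  avg (fun x => \sum_(j <- r | Q j) G j x) = \sum_(j <- r | Q j) avg (G j).
Proof.
by rewrite avgE exchange_big mulr_suml; apply: eq_bigr => j _; rewrite avgE.
Qed.

Lemma avg_le g h : (forall x, g x <= h x) -> avg g <= avg h.
Proof. by move=> gh; rewrite !avgE ler_wpM2r ?invr_ge0 ?ler0n ?ler_sum. Qed.

Lemma avg_ge0 g : (forall x, 0 <= g x) -> 0 <= avg g.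
Proof. by move=> g0; rewrite !avgE mulr_ge0 ?invr_ge0 ?sumr_ge0. Qed.

Lemma normr_avg g : `|avg g| <= avg (fun x => `|g x|).
Proof.
by rewrite !avgE normrM normfV normr_nat ler_wpM2r ?invr_ge0 ?ler_norm_sum.
Qed.

Hypothesis T_gt0 : (0 < #|T|)%N.

Lemma avg_cst (c : R) : avg (fun _ : T => c) = c.
Proof.
by rewrite !avgE sumr_const -[_ *+ _]mulr_natr mulfK // pnatr_eq0 -lt0n.
Qed.

Lemma avg_bound g C : (forall x, `|g x| <= C) -> `|avg g| <= C.
Proof.
move=> gC; apply: le_trans (normr_avg g) _; rewrite -[leRHS]avg_cst.
exact: avg_le.
Qed.

End avg.

Section local_statistics.
Variables (R : realType) (I : finType).
Local Notation S_I := {perm I}.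
Implicit Types (B h : S_I -> R) (S D : {set I}) (sigma rho tau : S_I).

Lemma card_perm_gt0 : (0 < #|{perm I}|)%N.
Proof. by apply/card_gt0P; exists 1%g. Qed.
Hint Resolve card_perm_gt0 : core.

Lemma avg_mulg tau h : avg (fun sigma => h (tau * sigma)%g) = avg h.
Proof.
rewrite !avgE; congr (_ / _); rewrite [RHS](reindex (fun s => tau * s)%g) //.
by apply: onW_bij; exists (fun s => tau^-1 * s)%g => s; rewrite ?mulKg ?mulKVg.
Qed.

Lemma avg_mulgr tau h : avg (fun sigma => h (sigma * tau)%g) = avg h.
Proof.
rewrite !avgE; congr (_ / _); rewrite [RHS](reindex (fun s => s * tau)%g) //.
by apply: onW_bij; exists (fun s => s * tau^-1)%g => s; rewrite ?mulgK ?mulgKV.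
Qed.

Lemma avg_exchange (G : S_I -> S_I -> R) :
  avg (fun s => avg (fun t => G s t)) = avg (fun t => avg (fun s => G s t)).
Proof.
rewrite (avgE (fun s => avg (G s))) [RHS]avgE; congr (_ / _).
under eq_bigr do rewrite avgE; under [RHS]eq_bigr do rewrite avgE.
by rewrite -!mulr_suml exchange_big.
Qed.

Definition depends_on S B :=
  forall sigma sigma', {in S, sigma =1 sigma'} -> B sigma = B sigma'.

(** Why covariances of a local [B] are computable.  Put a graft of an
    independent uniform [r] before [s]: the law of [s] is preserved, and [B]
    then reads the values of [r * s], which are independent of [s] because
    [r * s] is uniform for each fixed [s].  What remains of the covariance is
    the effect of the graft on [h], and a graft moves few points. *)
Lemma cov_graft S B h : depends_on S B ->
  avg (fun s => B s * h s) - avg B * avg h =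
  avg (fun r => avg (fun s =>
    B (r * s)%g * (h (graft (enum S) r * s)%g - h s))).
Proof.
move=> BS; under [in RHS]eq_avg do under eq_avg do rewrite mulrBr.
under [in RHS]eq_avg do rewrite avgB.
rewrite avgB; congr (_ - _).
  rewrite -[LHS](avg_cst card_perm_gt0); apply: eq_avg => r.
  rewrite -(avg_mulg (graft (enum S) r)); apply: eq_avg => s; congr (_ * _).
  by apply: BS => x xS; rewrite !permM graftE // mem_enum.
rewrite avg_exchange -avgZ; apply: eq_avg => s.
by rewrite avgZr avg_mulgr.
Qed.

Variables (phi : I -> {perm I} -> R) (S : I -> {set I}) (K : nat) (M : R).
Hypotheses (phi_dep : forall i, depends_on (S i) (phi i))
  (cardS : forall i, (#|S i| <= K)%N)
  (cardS' : forall a, (#|[set i | a \in S i]%SET| <= K)%N)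
  (phi_bd : forall i sigma, `|phi i sigma| <= M)
  (I_gt0 : (0 < #|I|)%N).

Definition local_sum sigma : R := \sum_i phi i sigma.
Local Notation U := local_sum.

Let M_ge0 : 0 <= M.
Proof.
by have /card_gt0P[i _] := I_gt0; exact: le_trans (phi_bd i 1%g).
Qed.

Definition touching D := [set i | ~~ [disjoint S i & D]]%SET.

Lemma card_touching D : (#|touching D| <= #|D| * K)%N.
Proof.
apply: (@leq_trans #|\bigcup_(a in D) [set i | a \in S i]%SET|).
  apply/subset_leq_card/fintype.subsetP => i; rewrite inE => /pred0Pn[a /=].
  case/andP=> aS aD.
  by apply/bigcupP; exists a => //; rewrite inE.
rewrite -sum_nat_const.
elim/big_ind2: _ => // [|A m B n Am Bn]; first by rewrite cards0.
by apply: leq_trans (leq_card_setU _ _) _; rewrite leq_add.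
Qed.

Definition supported D tau := forall x, tau x != x -> x \in D.

Lemma supported_touching D tau sigma i : supported D tau ->
  i \notin touching D -> phi i (tau * sigma)%g = phi i sigma.
Proof.
move=> tD; rewrite inE negbK => SD; apply: phi_dep => x xS; rewrite permM.
have [->//|/tD xD] := eqVneq (tau x) x.
by have := disjointFr SD xS; rewrite xD.
Qed.

Lemma local_sum_displacement D tau sigma : supported D tau ->
  U (tau * sigma)%g - U sigma =
  \sum_(i in touching D) (phi i (tau * sigma)%g - phi i sigma).
Proof.
move=> tD; rewrite /local_sum -sumrB [RHS]big_mkcond /=.
apply: eq_bigr => i _; case: ifPn => // iD.
by rewrite (supported_touching _ tD) // subrr.
Qed.

Lemma local_sum_displacement_le D tau sigma d : supported D tau ->
  (#|D| <= d)%N -> `|U (tau * sigma)%g - U sigma| <= (M + M) * (d * K)%:R.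
Proof.
move=> tD Dd; rewrite (local_sum_displacement _ tD).
apply: le_trans (ler_norm_sum _ _ _) _.
apply: (@le_trans _ _ (\sum_(i in touching D) (M + M))).
  apply: ler_sum => i _; apply: le_trans (ler_normB _ _) _.
  by rewrite lerD.
rewrite sumr_const -[_ *+ _]mulr_natr ler_wpM2l ?addr_ge0 // ler_nat.
by apply: leq_trans (card_touching D) _; rewrite leq_mul2r Dd orbT.
Qed.

Definition graft_set i rho : {set I} := (S i :|: rho @: S i)%SET.

(** The places that decide both a term of the sum and the effect on the sum of
    grafting at its window: the moved places and all windows that meet them. *)
Definition graft_nbhd i rho : {set I} :=
  (graft_set i rho :|: \bigcup_(j in touching (graft_set i rho)) S j)%SET.

Lemma supported_graft (A : {set I}) rho :
  supported (A :|: rho @: A)%SET (graft (enum A) rho).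
Proof.
move=> x /graft_support; rewrite !mem_enum inE => /orP[->//|rx].
by apply/orP; right; apply/imsetP; exists (rho^-1 x)%g; rewrite ?permKV.
Qed.

Lemma card_graft_set i rho : (#|graft_set i rho| <= K + K)%N.
Proof.
apply: leq_trans (leq_card_setU _ _) _.
by rewrite leq_add ?card_imset //; exact: perm_inj.
Qed.

Lemma card_graft_nbhd i rho :
  (#|graft_nbhd i rho| <= (K + K) + ((K + K) * K) * K)%N.
Proof.
apply: leq_trans (leq_card_setU _ _) _.
apply: leq_add; first exact: card_graft_set.
apply: (@leq_trans (#|touching (graft_set i rho)| * K)).
  rewrite -sum_nat_const.
  elim/big_rec2: _ => [|j m A _ Am]; first by rewrite cards0.
  by apply: leq_trans (leq_card_setU _ _) _; rewrite leq_add.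
rewrite leq_mul2r; apply/orP; right.
apply: leq_trans (card_touching _) _.
by rewrite leq_mul2r card_graft_set orbT.
Qed.

Let tau i rho := graft (enum (S i)) rho.

Lemma graft_increment_depends i rho :
  depends_on (graft_nbhd i rho)
    (fun s => phi i (rho * s)%g * (U (tau i rho * s)%g - U s)).
Proof.
move=> s s' ss'; have tD := @supported_graft (S i) rho.
congr (_ * _).
  apply: phi_dep => x xS; rewrite !permM; apply: ss'.
  by rewrite !inE imset_f ?orbT.
rewrite !(local_sum_displacement _ tD); apply: eq_bigr => j jD.
have Sj x : x \in S j -> x \in graft_nbhd i rho.
  by move=> xS; rewrite !inE; apply/orP; right; apply/bigcupP; exists j.
congr (_ - _); apply: phi_dep => x xS; last exact/ss'/Sj.
rewrite !permM; apply: ss'.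
have [->|tx] := eqVneq (tau i rho x) x; first exact: Sj.
by rewrite inE tD // (inj_eq perm_inj).
Qed.

Local Notation N := (#|I|%:R : R).
Local Notation rt := (Num.sqrt N).

Definition normalized_sum sigma : R := (U sigma - avg U) / rt.
Local Notation W := normalized_sum.

Let rt_gt0 : 0 < rt. Proof. by rewrite sqrtr_gt0 ltr0n. Qed.
Let rtE : rt * rt = N. Proof. by rewrite -expr2 sqr_sqrtr ?ler0n. Qed.

Lemma avg_normalized_mul h :
  avg (fun s => W s * h s) = rt^-1 * \sum_i avg (fun r => avg (fun s =>
    phi i (r * s)%g * (h (tau i r * s)%g - h s))).
Proof.
under [in RHS]eq_bigr do rewrite -(cov_graft _ (@phi_dep _)) //.
rewrite sumrB -[X in _ - X]mulr_suml -!avg_sum.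
under [X in rt^-1 * (X - _)]eq_avg do rewrite -mulr_suml.
rewrite -avgZ -avgB -avgZ; apply: eq_avg => s.
by rewrite /normalized_sum mulrAC -mulrBl [LHS]mulrC.
Qed.

Definition increment_bound : R := (M + M) * ((K + K) * K)%:R.

Definition stein_const : R :=
  M * increment_bound ^+ 2 + M * increment_bound * ((M + M) *
    (((K + K + (K + K) * K * K) + (K + K + (K + K) * K * K)) * K)%:R).

Let c1_ge0 : 0 <= increment_bound.
Proof. by rewrite mulr_ge0 ?addr_ge0. Qed.

Let increment_le i r s :
  `|U (tau i r * s)%g - U s| <= increment_bound.
Proof.
apply: local_sum_displacement_le (card_graft_set i r).
exact: supported_graft.
Qed.

Let normalized_diff s s' : W s - W s' = (U s - U s') / rt.
Proof. by rewrite /normalized_sum -mulrBl; congr (_ / _); ring. Qed.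

(** Stein's identity up to an error of order [N^(-1/2)].  Expand
    [E[W h(W)]] with [cov_graft] for each term of the sum and linearize [h]: the
    result is the mean of [h'(W)] times an average of local increments.  These
    are again local functions, so a second use of [cov_graft] separates them
    from [h'(W)], a single graft changing [W] by [O(N^(-1/2))] only.  The mean
    of the increments is [E[W^2]], by the first step with [h] the identity. *)
Lemma stein_estimate (h h' : R -> R) (C : R) : 0 <= C ->
  (forall a b, `|h b - h a - (b - a) * h' a| <= C * (b - a) ^+ 2) ->
  (forall a b, `|h' b - h' a| <= C * `|b - a|) ->
  `|avg (fun s => W s * h (W s)) -
    avg (fun s => W s ^+ 2) * avg (fun s => h' (W s))|
  <= C * stein_const / rt.
Proof.
move=> C0 hC h'C.
have -> : avg (fun s => W s ^+ 2) = rt^-1 * \sum_i avg (fun r => rt^-1 *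
    avg (fun s => phi i (r * s)%g * (U (tau i r * s)%g - U s))).
  under eq_avg do rewrite expr2.
  rewrite avg_normalized_mul; congr (_ * _); apply: eq_bigr => i _.
  apply: eq_avg => r; rewrite -avgZ; apply: eq_avg => s.
  by rewrite normalized_diff; ring.
rewrite (avg_normalized_mul (h \o W)) -[X in _ - X]mulrA -mulrBr mulr_suml -sumrB.
under eq_bigr do rewrite -avgZr -avgB.
rewrite normrM ger0_norm ?invr_ge0 ?(ltW rt_gt0) // mulrC.
rewrite ler_wpM2r ?invr_ge0 ?(ltW rt_gt0) //.
apply: le_trans (ler_norm_sum _ _ _) _.
apply: (@le_trans _ _ (\sum_(i : I) C * stein_const / N)); last first.
  by rewrite sumr_const -[_ *+ _]mulr_natr divfK // pnatr_eq0 -lt0n.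
apply: ler_sum => i _; apply: avg_bound => // r.
rewrite /stein_const; move: (increment_le i r) c1_ge0.
move: increment_bound => c1 c1_le c1_ge0'.
set B := fun s => phi i (r * s)%g * (U (tau i r * s)%g - U s).
have B_le s : `|B s| <= M * c1 by rewrite normrM ler_pM.
rewrite -(subrKA (rt^-1 * avg (fun s => B s * h' (W s)))).
apply: le_trans (ler_normD _ _) _.
rewrite /stein_const mulrDr mulrDl; apply: lerD.
  (* The error of linearizing [h]. *)
  rewrite -avgZ -avgB; apply: avg_bound => // s.
  have -> : phi i (r * s)%g * ((h \o W) (tau i r * s)%g - (h \o W) s) -
      rt^-1 * (B s * h' (W s)) = phi i (r * s)%g *
      (h (W (tau i r * s)%g) - h (W s) -
       (W (tau i r * s)%g - W s) * h' (W s)).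
    by rewrite normalized_diff /B /=; ring.
  have -> : C * (M * c1 ^+ 2) / N = M * (C * (c1 ^+ 2 / N)) by ring.
  rewrite normrM; apply: ler_pM => //.
  apply: le_trans (hC _ _) _; rewrite ler_wpM2l // normalized_diff.
  rewrite exprMn exprVn [rt ^+ 2]expr2 rtE ler_wpM2r ?invr_ge0 ?ler0n //.
  by rewrite -real_normK ?num_real // lerXn2r ?nnegrE.
(* The local increment is nearly uncorrelated with [h' (W s)]. *)
rewrite -[X in _ - X]mulrA -mulrBr normrM ger0_norm ?invr_ge0 ?(ltW rt_gt0) //.
rewrite (cov_graft _ (@graft_increment_depends i r)).
have -> : N^-1 = rt^-1 * rt^-1 by rewrite -invfM rtE.
rewrite [leRHS]mulrA [leLHS]mulrC ler_wpM2r ?invr_ge0 ?(ltW rt_gt0) //.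
apply: avg_bound => // r'; apply: avg_bound => // s.
set d := (_ + _ + _)%N.
have -> : C * (M * c1 * ((M + M) * (d * K)%:R)) / rt =
  (M * c1) * (C * ((M + M) * (d * K)%:R / rt)) by ring.
rewrite normrM -/(B _); apply: ler_pM => //.
apply: le_trans (h'C _ _) _; rewrite ler_wpM2l // normalized_diff.
rewrite normrM [X in _ * X]ger0_norm ?invr_ge0 ?(ltW rt_gt0) //.
rewrite ler_wpM2r ?invr_ge0 ?(ltW rt_gt0) //.
apply: local_sum_displacement_le; first exact: supported_graft.
apply: leq_trans (leq_card_setU _ _) _.
by rewrite card_imset ?leq_add ?card_graft_nbhd //; exact: perm_inj.
Qed.

End local_statistics.

(** * Trees as words *)
(** The recursion principle generated for the nested type gives no hypothesis
    on the subtrees. *)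
Lemma plane_tree_nested_ind (Q : plane_tree -> Prop) :
  (forall s, (forall T, T \in s -> Q T) -> Q (Node s)) -> forall T, Q T.
Proof.
move=> Qnode; fix IH 1; case=> s; apply: Qnode.
elim: s => [|T s IHs] T'; first by rewrite in_nil; discriminate.
rewrite inE => /predU1P[->|]; first exact: IH.
exact: IHs.
Qed.

Fixpoint word (T : plane_tree) : seq nat :=
  let: Node s := T in size s :: flatten (map word s).

Fixpoint subtrees (T : plane_tree) : seq plane_tree :=
  let: Node s := T in Node s :: flatten (map subtrees s).

Lemma map_fringe_vertices T : map (fringe T) (vertices T) = subtrees T.
Proof.
elim/plane_tree_nested_ind: T => s IH; rewrite /=; congr (_ :: _).
suff : forall p, map (fringe (Node (p ++ s)))
    (flatten [seq [seq iT.1 :: v | v <- iT.2]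
             | iT <- zip (iota (size p) (size s)) (map vertices s)]) =
    flatten (map subtrees s) by move/(_ [::]).
elim: s IH => //= T s IHs IH p.
rewrite map_cat -map_comp; congr (_ ++ _).
  rewrite -IH ?mem_head //; apply: eq_map => v /=.
  by rewrite nth_cat ltnn subnn.
rewrite -cat_rcons -[(size p).+1](size_rcons _ T) IHs // => T' T's.
by apply: IH; rewrite inE T's orbT.
Qed.

Lemma map_outdegree_subtrees T :
  map (fun T' => size (children T')) (subtrees T) = word T.
Proof.
elim/plane_tree_nested_ind: T => s IH; rewrite /= map_flatten -map_comp.
by congr (_ :: flatten _); apply/eq_in_map.
Qed.

Lemma size_subtrees T : size (subtrees T) = size (word T).
Proof. by rewrite -map_outdegree_subtrees size_map. Qed.

Lemma map_outdegree_vertices T : map (outdegree T) (vertices T) = word T.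
Proof. by rewrite -map_outdegree_subtrees -map_fringe_vertices -map_comp. Qed.

Lemma tree_size_word T : tree_size T = size (word T).
Proof. by rewrite -map_outdegree_vertices size_map. Qed.

Lemma tree_stat_word T i : tree_stat T i = count_mem i (word T).
Proof. by rewrite -map_outdegree_vertices count_map. Qed.

Lemma additive_functional_subtrees (R : realType) (f : plane_tree -> R) T :
  additive_functional f T = \sum_(T' <- subtrees T) f T'.
Proof. by rewrite /additive_functional -map_fringe_vertices big_map. Qed.

Lemma forest_cat_inj (s s' : seq plane_tree) (x y : seq nat) :
  (forall T, T \in s -> forall T' x y, word T ++ x = word T' ++ y ->
     T = T' /\ x = y) ->
  size s = size s' ->
  flatten (map word s) ++ x = flatten (map word s') ++ y -> s = s' /\ x = y.
Proof.
elim: s s' => [|T s IH] [|T' s'] //= wI [ss'].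
rewrite -!catA => /wI-/(_ (mem_head _ _))[-> e].
have [|-> ->] := IH s' _ ss' e; last by [].
by move=> T1 T1s; apply: wI; rewrite inE T1s orbT.
Qed.

(** No word of a tree is a proper prefix of another: the outdegrees tell where
    each subtree stops. *)
Lemma word_cat_inj T T' x y :
  word T ++ x = word T' ++ y -> T = T' /\ x = y.
Proof.
elim/plane_tree_nested_ind: T T' x y => s IH [s'] x y /= [ss'].
by case/(forest_cat_inj IH ss') => -> ->.
Qed.

Lemma word_inj : injective word.
Proof.
by move=> T T' e; case: (@word_cat_inj T T' [::] [::]); rewrite ?cats0.
Qed.

Lemma size_word_gt0 T : (0 < size (word T))%N. Proof. by case: T. Qed.

(** In depth-first order the descendants of a vertex follow it immediately, so
    its fringe subtree can be read off at its place in the word. *)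
Lemma drop_word T0 T i : (i < size (word T))%N ->
  exists r, drop i (word T) = word (nth T0 (subtrees T) i) ++ r.
Proof.
elim/plane_tree_nested_ind: T i => s IH [_|i] /=; first by exists [::]; rewrite cats0.
rewrite ltnS; elim: s i IH => // T s IHs i IH /=.
rewrite size_cat drop_cat nth_cat size_subtrees.
case: (ltnP i (size (word T))) => iT; last first.
  move=> iTs; apply: IHs; last by rewrite ltn_subLR.
  by move=> T' T's; apply: IH; rewrite inE T's orbT.
move=> _; have [r ->] := IH T (mem_head _ _) i iT.
by exists (r ++ flatten (map word s)); rewrite catA.
Qed.

(** A parser with [k] trees still to be read: a vertex with [a] children
    replaces one of them by [a] others.  It accepts [x] when [x] is the
    concatenation of the words of [k] trees. *)
Fixpoint parses (k : nat) (x : seq nat) : bool :=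
  if x is a :: y then if k is k'.+1 then parses (k' + a) y else false
  else k == 0%N.

Lemma parsesP k x : parses k x ->
  exists2 s, size s = k & x = flatten (map word s).
Proof.
elim: x k => [|a x IH] k /=; first by move/eqP->; exists [::].
case: k => // k /IH[s sE ->]; exists (Node (take a s) :: drop a s) => /=.
  by rewrite size_drop sE addnK.
rewrite -flatten_cat -map_cat cat_take_drop size_takel //.
by rewrite sE leq_addl.
Qed.

Lemma parses_word T k x : parses k x -> parses k.+1 (word T ++ x).
Proof.
elim/plane_tree_nested_ind: T k x => s IH k x /= kx.
elim: s IH k x kx => /= [|T s IHs] IH k x kx; first by rewrite addn0.
rewrite addnS -catA; apply: (IH _ (mem_head _ _)); apply: IHs => //.
by move=> T' T's; apply: IH; rewrite inE T's orbT.
Qed.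

Lemma parses1P x : reflect (exists T, x = word T) (parses 1 x).
Proof.
apply: (iffP idP) => [/parsesP[[|T[|]] // _ ->]|[T ->]].
  by exists T; rewrite /= cats0.
by rewrite -[word T]cats0 parses_word.
Qed.

(** The usual description by a walk with steps [a - 1], written with sums of
    prefixes so as to stay within natural numbers. *)
Lemma parsesE k x : parses k x =
  [forall j : 'I_(size x), (j < sumn (take j x) + k)%N] &&
  (sumn x + k == size x)%N.
Proof.
elim: x k => [|a x IH] k /=.
  by rewrite add0n; case: forallP => //= -[] [].
case: k => [|k].
  by apply/esym/negP => /andP[/forallP/(_ ord0)].
rewrite IH; congr (_ && _); last by apply/eqP/eqP; lia.
apply/forallP/forallP => H j.
  case: j => [[|j]] jx //=; have := H (Ordinal (jx : (j < size x)%N)) => /=; lia.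
have := H (lift ord0 j); rewrite /= /bump /= add0n; lia.
Qed.

Lemma parses_prefix k u v : parses k (u ++ v) -> v != [::] ->
  (size u < sumn u + k)%N.
Proof.
rewrite parsesE => /andP[/forallP uv _] v0.
have uv' : (size u < size (u ++ v))%N by rewrite size_cat; case: v v0 {uv} => // a v _; rewrite /=; lia.
by have := uv (Ordinal uv'); rewrite /= take_size_cat.
Qed.

(** * Fringe subtrees as factors of a cyclic word *)
Section tree_patterns.
Variables (R : realType) (supp : seq plane_tree).
Implicit Types (g : plane_tree -> R) (x : seq nat).

Definition pattern_value g x : R :=
  \sum_(T <- supp) g T * (prefix (word T) x)%:R.

Lemma prefix_word T T' r : prefix (word T) (word T' ++ r) = (T == T').
Proof.
apply/prefixP/eqP => [[y /esym/word_cat_inj[]//]|->]; by exists r.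
Qed.

Lemma pattern_value_word g T r : uniq supp ->
  (T \notin supp -> g T = 0) -> pattern_value g (word T ++ r) = g T.
Proof.
move=> supp_uniq gT; rewrite /pattern_value.
under eq_bigr do rewrite prefix_word.
have [Ts|/[dup] Ts /gT->] := boolP (T \in supp).
  rewrite (bigD1_seq T) //= eqxx mulr1 big1 ?addr0 // => T' /negbTE->.
  by rewrite mulr0.
rewrite big_seq big1 // => T' T's; case: eqVneq => [T'T|]; last by rewrite mulr0.
by rewrite -T'T T's in Ts.
Qed.

Definition rot_sum (h : seq nat -> R) x : R := \sum_(j < size x) h (rot j x).

Lemma rot_sum_rot1 h x : rot_sum h (rot 1 x) = rot_sum h x.
Proof.
rewrite /rot_sum size_rot; case: x => [|a x]; first by rewrite !big_ord0.
rewrite [LHS]big_ord_recr [RHS]big_ord_recl /= addrC; congr (_ + _).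
  by congr h; rewrite rot_rot -rotS //= rot_oversize //= rot0.
apply: eq_bigr => i _; congr h.
by rewrite /bump /= add1n rot_rot -rotS //= ltnS ltnW.
Qed.

Lemma rot_sum_rot h n x : rot_sum h (rot n x) = rot_sum h x.
Proof.
elim: n => [|n IH]; first by rewrite rot0.
have [nx|xn] := ltnP n (size x); first by rewrite rotS // rot_sum_rot1.
by rewrite rot_oversize // ltnW.
Qed.

(** Places and vertices correspond by [drop_word].  Reading cyclically creates
    no further occurrence, since at each place the word of a subtree is already
    there and no word of a tree is a proper prefix of another. *)
Lemma additive_functional_rot_sum g T : uniq supp ->
  (forall T, T \notin supp -> g T = 0) ->
  additive_functional g T = rot_sum (pattern_value g) (word T).
Proof.
move=> supp_uniq g0; rewrite additive_functional_subtrees (big_nth T).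
rewrite size_subtrees big_mkord; apply: eq_bigr => i _; rewrite /rot.
have [r ->] := drop_word T (ltn_ord i).
rewrite -catA pattern_value_word //; exact: g0.
Qed.

End tree_patterns.

(** * The cycle lemma and uniform arrangements *)
(** Cycle lemma: start just after the first minimum of the walk with steps
    [a - 1].  Two distinct valid starts would cut the cycle into two arcs, each
    of them a proper prefix of a tree word, hence with nonnegative total, while
    the total over the cycle is [-1]. *)
Lemma rot_cycle_unique x : (sumn x + 1 = size x)%N ->
  exists2 r : 'I_(size x), parses 1 (rot r.+1 x) &
    forall r' : 'I_(size x), parses 1 (rot r'.+1 x) -> r' = r.
Proof.
move=> xE; have x0 : (0 < size x)%N by lia.
pose h (j : nat) := (sumn (take j x) + (size x - j))%N.
(* The walk is shifted by the length to be a natural number, and [F] orders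
   places lexicographically by height and then by position. *)
pose F (j : 'I_(size x)) := (h j.+1 * size x + j)%N.
case: (@arg_minnP _ (Ordinal x0) predT F isT) => r _ rmin.
have rN : (r < size x)%N := ltn_ord r.
have hN : h (size x) = sumn x by rewrite /h take_size subnn addn0.
have h0 : h 0%N = size x by rewrite /h take0 subn0.
have hr j : (0 < j <= size x)%N -> (h r.+1 <= h j)%N /\ ((j <= r)%N -> (h r.+1 < h j)%N).
  case: j => // j /= jN; have := rmin (Ordinal jN) isT; rewrite /F /=.
  move: (h r.+1) (h j.+1) => A B AB.
  have [BA|AB'] := ltnP B A; last split=> // jr; last first.
    by rewrite ltn_neqAle AB' andbT; apply: contraTneq AB => ->; rewrite leq_add2l -ltnNge.
  have : (B.+1 * size x <= A * size x)%N by rewrite leq_mul2r BA orbT.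
  by rewrite mulSn; lia.
have pr : parses 1 (rot r.+1 x).
  rewrite parsesE sumn_rot size_rot xE eqxx andbT; apply/forallP => -[j jN] /=.
  rewrite /rot take_cat size_drop.
  case: (ltnP j ((size x) - r.+1)) => jr.
    have jN' : (0 < r.+1 + j <= size x)%N by lia.
    by have := (hr _ jN').1; rewrite /h takeD sumn_cat; lia.
  rewrite sumn_cat take_takel; last by lia.
  set i := (j - ((size x) - r.+1))%N.
  have dE : (sumn (take r.+1 x) + sumn (drop r.+1 x) = sumn x)%N.
    by rewrite -sumn_cat cat_take_drop.
  have hi : (h r.+1 < h i)%N.
    have [i0|i0] := posnP i; first by rewrite i0 h0; have := (hr (size x) _).1; lia.
    by apply: (hr i _).2; lia.
  by move: hi; rewrite /h; lia.
have uniqueness (a b : 'I_(size x)) : (a < b)%N ->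
    parses 1 (rot a.+1 x) -> parses 1 (rot b.+1 x) -> False.
  move=> ab pa pb; pose w := rot a.+1 x; pose d := (b - a)%N.
  have wN : size w = size x by rewrite size_rot.
  have bN := ltn_ord b.
  have wE : rot b.+1 x = drop d w ++ take d w.
    by rewrite -/(rot d w) /w -rotD; [congr rot; lia | lia].
  have sd : size (drop d w) = (size x - d)%N by rewrite size_drop wN.
  have st : size (take d w) = d by rewrite size_takel // wN; lia.
  have sw : (sumn (take d w) + sumn (drop d w) = sumn x)%N.
    by rewrite -sumn_cat cat_take_drop sumn_rot.
  have d0 : drop d w != [::] by rewrite -size_eq0 sd; lia.
  have t0 : take d w != [::] by rewrite -size_eq0 st; lia.
  rewrite wE in pb; have ub := parses_prefix pb t0.
  rewrite -/w -(cat_take_drop d w) in pa; have ua := parses_prefix pa d0.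
  by move: ua ub; rewrite sd st; lia.
exists r => // r' pr'; apply/val_inj/eqP => /=.
case: ltngtP => // rr'; exfalso; [exact: uniqueness rr' pr' pr|exact: uniqueness rr' pr pr'].
Qed.

Section arrangement.
Variables (N : nat) (y : N.-tuple nat).
Implicit Type sigma : {perm 'I_N}.

Definition arrangement sigma : seq nat := [seq tnth y (sigma i) | i <- enum 'I_N].
Local Notation arr := arrangement.

Lemma size_arrangement sigma : size (arr sigma) = N.
Proof. by rewrite size_map size_enum_ord. Qed.

Lemma nth_arrangement sigma (i : 'I_N) : nth 0%N (arr sigma) i = tnth y (sigma i).
Proof. by rewrite (nth_map i) ?size_enum_ord // nth_ord_enum. Qed.

Definition cyclic_shift : {perm 'I_N} := perm (@ordS_inj N).

Lemma cyclic_shiftX i (j : 'I_N) : ((cyclic_shift ^+ i)%g j = (i + j) %% N :> nat)%N.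
Proof.
elim: i j => [|i IH] j; first by rewrite expg0 perm1 add0n modn_small.
by rewrite expgS permM IH permE /= modnDmr addnS.
Qed.

Lemma arrangement_shift i sigma : (i <= N)%N ->
  arr (cyclic_shift ^+ i * sigma)%g = rot i (arr sigma).
Proof.
move=> iN; apply: (@eq_from_nth _ 0%N); first by rewrite size_rot !size_arrangement.
rewrite size_arrangement => j jN.
rewrite (nth_arrangement _ (Ordinal jN)) permM -nth_arrangement cyclic_shiftX /=.
rewrite /rot nth_cat size_drop size_arrangement nth_drop.
case: (ltnP j (N - i)) => ijN; first by rewrite modn_small; [|lia].
rewrite nth_take; last by lia.
congr nth; rewrite -[(i + j)%N](subnK (_ : N <= i + j)%N); last by lia.
by rewrite modnDr modn_small; lia.
Qed.

Lemma perm_arrangement sigma : perm_eq (arr sigma) y.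
Proof.
apply/tuple_permP; exists sigma.
by rewrite /= /codom_tuple; apply: eq_map => i.
Qed.

Lemma perm_eq_arrangement x : perm_eq x y -> exists sigma, x = arr sigma.
Proof.
move=> /tuple_permP[sigma ->]; exists sigma; exact: eq_map.
Qed.

Variable R : realType.

Lemma avg_rot (H : seq nat -> R) i : (i <= N)%N ->
  avg (fun s => H (rot i (arr s))) = avg (fun s => H (arr s)).
Proof.
move=> iN; rewrite -[RHS](avg_mulg (cyclic_shift ^+ i)%g).
by apply: eq_avg => s; rewrite arrangement_shift.
Qed.

(** All arrangements arise from equally many permutations: the fibres are
    cosets of a stabilizer. *)
Lemma card_arrangement sigma :
  #|[set s | arr s == arr sigma]%SET| = #|[set s | arr s == y :> seq nat]%SET|.
Proof.
have arrP s x : arr s = arr x <-> forall i, tnth y (s i) = tnth y (x i).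
  split=> [sx i|sx]; last exact: eq_map.
  by rewrite -!nth_arrangement sx.
have arr1 : y = arr 1%g :> seq nat.
  by rewrite -[LHS]map_tnth_enum; apply: eq_map => i; rewrite perm1.
rewrite -[RHS](card_imset _ (mulgI sigma)) arr1; apply: eq_card => s.
rewrite !inE; apply/eqP/imsetP => [/arrP ss|[t]].
  exists (sigma^-1 * s)%g; last by rewrite mulKVg.
  by rewrite inE; apply/eqP/arrP => i; rewrite permM perm1 ss permKV.
rewrite inE => /eqP/arrP t1 ->; apply/arrP => i.
by rewrite permM t1 perm1.
Qed.

(** Counting pairs of a permutation and a rotation that yield the word of a
    tree: each permutation admits exactly one rotation, and each tree is
    obtained equally often.  The hypothesis on [sumn y] is the one of the cycle
    lemma. *)
Lemma avg_trees (D : seq plane_tree) (H : seq nat -> R) :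
  uniq D -> (forall T, T \in D = perm_eq (word T) y) ->
  (sumn y + 1 = N)%N -> (forall n x, H (rot n x) = H x) ->
  avg (fun s => H (arr s)) = (\sum_(T <- D) H (word T)) / (size D)%:R.
Proof.
move=> D_uniq DE yN H_rot.
pose kappa := #|[set s | arr s == y :> seq nat]%SET|.
have key (G : seq nat -> R) : (forall n x, G (rot n x) = G x) ->
    \sum_(s : {perm 'I_N}) G (arr s) = N%:R * kappa%:R * \sum_(T <- D) G (word T).
  move=> G_rot.
  have -> : \sum_(s : {perm 'I_N}) G (arr s) = \sum_(s : {perm 'I_N}) \sum_(r < N)
      (parses 1 (rot r.+1 (arr s)))%:R * G (rot r.+1 (arr s)).
    apply: eq_bigr => s _; under eq_bigr do rewrite G_rot.
    rewrite -mulr_suml.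
    have sE : (sumn (arr s) + 1 = size (arr s))%N.
      by rewrite (perm_sumn (perm_arrangement s)) size_arrangement.
    have [r pr r_uniq] := rot_cycle_unique sE.
    rewrite size_arrangement in r pr r_uniq.
    rewrite (bigD1 r) //= pr big1 ?addr0 ?mul1r // => r' r'r.
    by case: (boolP (parses _ _)) => // /r_uniq r'E; rewrite r'E eqxx in r'r.
  rewrite exchange_big /=.
  have -> : \sum_(r < N) \sum_(s : {perm 'I_N})
      (parses 1 (rot r.+1 (arr s)))%:R * G (rot r.+1 (arr s)) =
      \sum_(r < N) \sum_(s : {perm 'I_N}) (parses 1 (arr s))%:R * G (arr s).
    apply: eq_bigr => r _.
    rewrite [RHS](reindex (fun s => cyclic_shift ^+ r.+1 * s)%g) /=.
      by apply: eq_bigr => s _; rewrite arrangement_shift.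
    apply: onW_bij.
    by exists (fun s => (cyclic_shift ^+ r.+1)^-1 * s)%g => s; rewrite ?mulKg ?mulKVg.
  rewrite sumr_const card_ord -[LHS]mulr_natl -[RHS]mulrA; congr (_ * _).
  rewrite mulr_sumr.
  have -> : \sum_(s : {perm 'I_N}) (parses 1 (arr s))%:R * G (arr s) =
      \sum_(s : {perm 'I_N}) \sum_(T <- D) (arr s == word T)%:R * G (word T).
    apply: eq_bigr => s _; case: parses1P => [[T sT]|nT]; last first.
      rewrite mul0r big1 // => T _; case: eqVneq => [sT|]; last by rewrite mul0r.
      by case: nT; exists T.
    have TD : T \in D by rewrite DE -sT perm_arrangement.
    rewrite (bigD1_seq T) //= sT eqxx big1 ?addr0 // => T' T'T.
    by rewrite (inj_eq word_inj) eq_sym (negbTE T'T) mul0r.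
  rewrite exchange_big /= big_seq [RHS]big_seq; apply: eq_bigr => T.
  rewrite DE => /perm_eq_arrangement[sigma ->]; rewrite -mulr_suml; congr (_ * _).
  rewrite /kappa -(card_arrangement sigma) -sum1_card natr_sum [RHS]big_mkcond /=.
  by apply: eq_bigr => s _; rewrite inE; case: (_ == _).
have nz : N%:R * kappa%:R != 0 :> R.
  have := key (fun=> 1) (fun _ _ => erefl).
  rewrite sumr_const => /eqP; apply: contraTneq => ->; rewrite mul0r pnatr_eq0.
  by rewrite -lt0n card_perm_gt0.
rewrite avgE (key _ H_rot).
have -> : #|{perm 'I_N}|%:R = N%:R * kappa%:R * (size D)%:R :> R.
  have := key (fun=> 1) (fun _ _ => erefl).
  by rewrite sumr_const big_const_seq count_predT iter_addr_0 => ->.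
by rewrite invfM mulrACA divff // mul1r.
Qed.

End arrangement.

(** * Occurrences of words in a uniform arrangement *)

(** Probability that given distinct places of a uniform arrangement carry the
    letters of [w], when [x a] is the frequency of [a] and [e] the inverse of
    the number of places: each letter already used is no longer available. *)
Fixpoint draw_prob (R : realType) (x : nat -> R) (e : R) (w : seq nat) : R :=
  if w is a :: w' then
    draw_prob x e w' * ((x a - (count_mem a w')%:R * e) / (1 - (size w')%:R * e))
  else 1.

Section occurrences.
Variables (R : realType) (N : nat) (y : N.-tuple nat).
Implicit Type sigma : {perm 'I_N}.
Local Notation arr := (arrangement y).

Definition freq (a : nat) : R := (count_mem a y)%:R / N%:R.
Local Notation q := (draw_prob freq N%:R^-1).

Definition occurs (s : seq 'I_N) (w : seq nat) sigma :=
  [seq tnth y (sigma i) | i <- s] == w.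

Lemma count_occurs s w a sigma : uniq s -> occurs s w sigma ->
  ((\sum_(b | b \notin s) (tnth y (sigma b) == a)%:R) : R) =
  (count_mem a y)%:R - (count_mem a w)%:R.
Proof.
move=> s_uniq /eqP <-.
have -> : count_mem a y = count_mem a (arr sigma).
  exact/esym/seq.permP/perm_arrangement.
rewrite -!sum1_count !natr_sum /arrangement.
rewrite [X in _ = _ - X]big_map [X in _ = X - _]big_map big_enum_cond /=.
rewrite [X in _ = X - _](bigID (mem s)) /=.
have -> : \sum_(i <- s | tnth y (sigma i) == a) 1 =
    \sum_(i | (tnth y (sigma i) == a) && (i \in s)) (1 : R).
  rewrite big_mkcond big_uniq //= -big_mkcondr /=.
  by apply: eq_bigl => j; rewrite andbC.
rewrite addrAC subrr add0r big_mkcond [RHS]big_mkcond /=.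
by apply: eq_bigr => b _; case: (b \in s); rewrite ?andbF ?andbT //=; case: eqP.
Qed.

(** By symmetry a further place is as likely to carry [a] as any other unused
    place, and [count_occurs] counts the unused copies of [a]. *)
Lemma avg_occurs s w : uniq s -> size s = size w ->
  avg (fun g => (occurs s w g)%:R) = q w.
Proof.
elim: w s => [|a w IH] [|b s] //= s_uniq sw.
  by rewrite -[RHS](avg_cst (card_perm_gt0 'I_N)); apply: eq_avg => g.
case/andP: s_uniq => bs s_uniq; case: sw => sw.
have N0 : N%:R != 0 :> R by rewrite pnatr_eq0 -lt0n (leq_trans _ (ltn_ord b)).
have sN : (size s < N)%N.
  have := max_card (mem (b :: s)); rewrite card_ord (card_uniqP _) //=.
  by rewrite bs.
pose h b' sigma : R := (tnth y (sigma b') == a)%:R * (occurs s w sigma)%:R.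
have occE sigma : (occurs (b :: s) (a :: w) sigma)%:R = h b sigma.
  by rewrite /h /occurs /= eqseq_cons -natrM mulnb.
under eq_avg do rewrite occE.
have sym b' : b' \notin s -> avg (h b') = avg (h b).
  move=> b's; rewrite -[LHS](avg_mulg (tperm b b')); apply: eq_avg => g.
  rewrite /h permM tpermR; congr ((_ == _)%:R * _%:R).
  rewrite /occurs; congr (_ == _); apply/eq_in_map => i is_; rewrite permM tpermD //.
    by apply: contraNneq bs => ->.
  by apply: contraNneq b's => ->.
have tot : avg (h b) * (N - size s)%:R = q w * ((count_mem a y)%:R - (count_mem a w)%:R).
  have -> : avg (h b) * (N - size s)%:R = \sum_(b' | b' \notin s) avg (h b').
    rewrite (eq_bigr (fun=> avg (h b))) // sumr_const mulr_natr; congr (_ *+ _).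
    by rewrite -(card_uniqP s_uniq) -[X in (X - _)%N](card_ord N) -(cardC (mem s)) addKn; apply: eq_card => j; rewrite !inE.
  rewrite -(IH s) // -avgZr -avg_sum; apply: eq_avg => g; rewrite /h -mulr_suml mulrC.
  case: (boolP (occurs s w g)) => [/(count_occurs a s_uniq)->|_]; first by [].
  by rewrite !mul0r.
have NsR : (N - size s)%:R != 0 :> R by rewrite pnatr_eq0 subn_eq0 -ltnNge.
rewrite -[LHS](mulfK NsR) tot -mulrA; congr (_ * _).
rewrite natrB ?(ltnW sN) // -sw /freq.
by field; rewrite N0 -natrB ?(ltnW sN).
Qed.

Local Notation pat T x := ((prefix (word T) x)%:R : R).

Lemma avg_prefix T : (size (word T) <= N)%N ->
  avg (fun g => pat T (arr g)) = q (word T).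
Proof.
move=> TN; rewrite -(@avg_occurs (take (size (word T)) (enum 'I_N))).
- by apply: eq_avg => g; rewrite prefixE /occurs map_take.
- exact/take_uniq/enum_uniq.
- by rewrite size_takel // size_enum_ord.
Qed.

Definition pair_avg j T T' : R := avg (fun g => pat T (arr g) * pat T' (rot j (arr g))).

Lemma pair_avg_nested j T T' : (size (word T) <= N)%N -> (j < size (word T))%N ->
  pair_avg j T T' = (nth T (subtrees T) j == T')%:R * q (word T).
Proof.
move=> TN jT; rewrite -avg_prefix // -avgZ; apply: eq_avg => g.
case: prefixP => [[r ->]|_]; last by rewrite mul0r mulr0.
rewrite mul1r mulr1 /rot drop_cat jT.
by have [r' ->] := drop_word T jT; rewrite -!catA prefix_word eq_sym.
Qed.

Lemma pair_avg_disjoint j T T' :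
  (size (word T) <= j)%N -> (j + size (word T') <= N)%N ->
  pair_avg j T T' = q (word T ++ word T').
Proof.
move=> Tj jT'.
pose s1 := take (size (word T)) (enum 'I_N).
pose s2 := take (size (word T')) (drop j (enum 'I_N)).
have ss1 : size s1 = size (word T) by rewrite size_takel // size_enum_ord; lia.
have ss2 : size s2 = size (word T').
  by rewrite size_takel // size_drop size_enum_ord; lia.
rewrite -(@avg_occurs (s1 ++ s2)).
- apply: eq_avg => g; rewrite -natrM mulnb; congr (_%:R); congr nat_of_bool.
  rewrite /occurs map_cat eqseq_cat ?size_map ?ss1 // /s1 /s2 !map_take map_drop.
  rewrite !prefixE; congr (_ && (_ == _)).
  rewrite /rot takel_cat; first by [].
  by rewrite size_drop size_arrangement -[X in (X <= _)%N](addKn j) leq_sub2r.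
- apply: (subseq_uniq _ (enum_uniq 'I_N)).
  rewrite -[X in subseq _ X](cat_take_drop j) cat_subseq ?take_subseq //.
  by rewrite /s1 -(@take_takel _ _ j) // take_subseq.
- by rewrite !size_cat ss1 ss2.
Qed.

Lemma pair_avg_rev j T T' : (j <= N)%N -> pair_avg (N - j) T T' = pair_avg j T' T.
Proof.
move=> jN; rewrite /pair_avg.
rewrite -(avg_rot y (fun x => pat T x * pat T' (rot (N - j) x)) jN).
apply: eq_avg => g; rewrite -rotD ?size_arrangement ?subnK // mulrC.
by rewrite rot_oversize // size_arrangement.
Qed.

(** The second word starts inside the first, or after it, or the first starts
    inside the second.  Overlapping occurrences of two tree words are nested,
    and the case of equal starting points must not be counted twice. *)
Lemma sum_pair_avg T T' : (size (word T) + size (word T') <= N)%N ->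
  \sum_(j < N) pair_avg j T T' =
  (count_mem T' (subtrees T))%:R * q (word T) +
  ((count_mem T (subtrees T'))%:R - (T == T')%:R) * q (word T') +
  (N%:R - (size (word T))%:R - (size (word T'))%:R + 1) * q (word T ++ word T').
Proof.
move=> TN; have T0 := size_word_gt0 T; have T'0 := size_word_gt0 T'.
have nested (A B : plane_tree) : (size (word A) <= N)%N ->
    \sum_(0 <= j < size (word A)) pair_avg j A B = (count_mem B (subtrees A))%:R * q (word A).
  move=> AN; rewrite big_mkord -sum1_count natr_sum (big_nth A) size_subtrees [X in _ = X * _]big_mkord.
  rewrite [X in _ = X * _]big_mkcond /= mulr_suml; apply: eq_bigr => j _.
  by rewrite pair_avg_nested //; case: eqP.
rewrite -(big_mkord predT (fun j => pair_avg j T T')).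
rewrite (@big_cat_nat _ _ _ (size (word T))) //=; last by lia.
rewrite nested; last by lia.
rewrite -addrA; congr (_ + _).
rewrite (@big_cat_nat _ _ _ (N - size (word T')).+1) //=; [|lia|lia].
rewrite addrC; congr (_ + _).
  rewrite mulrBl -nested; last by lia.
  rewrite -{2}(prednK T'0) big_nat_recl // pair_avg_nested //; last by lia.
  rewrite [nth _ _ _](_ : _ = T'); last by case: (T').
  rewrite [T == T']eq_sym addrAC subrr add0r.
  rewrite big_nat_rev /= -{1}[(N - _).+1]add0n big_addn.
  have -> : (N - (N - size (word T')).+1 = (size (word T')).-1)%N by lia.
  apply: eq_big_nat => i iT'.
  rewrite -[RHS]pair_avg_rev; last by lia.
  by congr pair_avg; lia.
rewrite (eq_big_nat _ _ (F2 := fun=> q (word T ++ word T'))).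
  rewrite big_const_nat iter_addr_0 -[LHS]mulr_natl; congr (_ * _).
  have -> : ((N - size (word T')).+1 - size (word T) = N + 1 - size (word T) - size (word T'))%N by lia.
  by rewrite !natrB ?natrD; [ring|lia|lia].
by move=> j jT; rewrite pair_avg_disjoint //; lia.
Qed.

End occurrences.

Local Open Scope classical_set_scope.
Local Open Scope ring_scope.

(** * The characteristic function of a local statistic *)

Section calculus.
Variable R : realType.

Lemma is_derive_bigsum (J : Type) (r : seq J) (F : J -> R -> R) (dF : J -> R)
    (x : R) : (forall j, is_derive x 1 (F j) (dF j)) ->
  is_derive x 1 (fun t => \sum_(j <- r) F j t) (\sum_(j <- r) dF j).
Proof.
move=> FdF; elim: r => [|j r IH].
  rewrite big_nil; under eq_fun do rewrite big_nil.
  exact: is_derive_cst.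
rewrite big_cons; under eq_fun do rewrite big_cons.
exact: is_deriveD.
Qed.

Lemma mean_value (f f' : R -> R) : (forall x : R, is_derive x 1 f (f' x)) ->
  forall a b, exists2 c, `|c - a| <= `|b - a| & f b - f a = f' c * (b - a).
Proof.
move=> ff' a b.
have cf x y : {within `[x, y], continuous f}.
  apply: continuous_subspaceT => z; apply: differentiable_continuous.
  by apply/derivable1_diffP; have [] := ff' z.
have [ab|/ltW ba] := leP a b.
  have [c] := MVT_segment ab (fun x _ => ff' x) (cf a b).
  rewrite in_itv /= => /andP[ac cb] fE; exists c => //.
  by rewrite !ger0_norm ?subr_ge0 // lerB.
have [c] := MVT_segment ba (fun x _ => ff' x) (cf b a).
rewrite in_itv /= => /andP[ac cb] fE; exists c.
  by rewrite distrC [leRHS]distrC !ger0_norm ?subr_ge0 // lerB.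
by rewrite -opprB fE -mulrN opprB.
Qed.

Lemma is_derive_affine (t a th : R) :
  is_derive t 1 (fun u : R => u * a + th) a.
Proof.
have -> : (fun u : R => u * a + th) = (a *: (id : R -> R)) + cst th.
  by apply/funext => u; rewrite !fctE /GRing.scale /= mulrC.
rewrite -[a in is_derive _ _ _ a](_ : a *: 1 + 0 = a); last first.
  by rewrite addr0 /GRing.scale /= mulr1.
by apply: is_deriveD; apply: is_deriveZ.
Qed.

Lemma is_derive_sin_affine (t a th : R) :
  is_derive t 1 (fun u : R => sin (u * a + th)) (a * cos (t * a + th)).
Proof.
rewrite mulrC; apply: (@is_derive1_comp _ sin (fun u => u * a + th)).
exact: is_derive_affine.
Qed.

Lemma is_derive_cos_affine (t a th : R) :
  is_derive t 1 (fun u : R => cos (u * a + th)) (- (a * sin (t * a + th))).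
Proof.
rewrite mulrC -mulNr; apply: (@is_derive1_comp _ cos (fun u => u * a + th)).
exact: is_derive_affine.
Qed.

Lemma cos_affine_lipschitz (t th a b : R) :
  `|t * cos (t * b + th) - t * cos (t * a + th)| <= t ^+ 2 * `|b - a|.
Proof.
have [|c _] := mean_value (f := fun u => t * cos (u * t + th))
  (f' := fun u => t * (- (t * sin (u * t + th)))) _ a b.
  move=> x; apply: is_deriveZ; exact: is_derive_cos_affine.
rewrite [b * t]mulrC [a * t]mulrC => ->; rewrite !normrM normrN normrM.
rewrite ler_wpM2r // mulrA -expr2 real_normK ?num_real //.
by rewrite ler_piMr ?sqr_ge0 ?sin_max.
Qed.

Lemma sin_affine_taylor (t th a b : R) :
  `|sin (t * b + th) - sin (t * a + th) - (b - a) * (t * cos (t * a + th))|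
  <= t ^+ 2 * (b - a) ^+ 2.
Proof.
have [|c ca] := mean_value (f := fun u => sin (u * t + th))
  (f' := fun u => t * cos (u * t + th)) _ a b.
  move=> x; exact: is_derive_sin_affine.
rewrite [b * t]mulrC [a * t]mulrC [c * t]mulrC => ->.
rewrite [t * _ * _]mulrC -mulrBr normrM.
apply: le_trans (ler_wpM2l _ (cos_affine_lipschitz _ _ _ _)) _ => //.
rewrite mulrCA ler_wpM2l ?sqr_ge0 // -[leRHS]real_normK ?num_real //.
by rewrite expr2 ler_wpM2l.
Qed.

(** Gronwall-type comparison: a function almost solving the equation
    [y' = - v t y] of the Gaussian characteristic function is close to the
    solution, because the integrating factor [expR (v t^2 / 2)] turns the
    defect into a small derivative. *)
Lemma gaussian_ode (y y' : R -> R) (v k : R) : 0 <= v -> 0 <= k ->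
  (forall t : R, is_derive t 1 y (y' t)) ->
  (forall t, `|y' t + v * t * y t| <= k * t ^+ 2) ->
  forall t, `|y t - y 0 * expR (- (v * t ^+ 2 / 2))| <= k * `|t| ^+ 3.
Proof.
move=> v0 k0 yy' ode t.
pose e t := expR (v * t ^+ 2 / 2).
have de (s : R) : is_derive s 1 e (e s * (v * s)).
  apply: (@is_derive1_comp _ expR (fun s => v * s ^+ 2 / 2)).
  have -> : v * s = v / 2 * (s * 1 + s * 1) by field.
  have -> : (fun s : R => v * s ^+ 2 / 2) = v / 2 *: ((id : R -> R) * id).
    by apply/funext => x; rewrite !fctE /GRing.scale /=; field.
  apply: is_deriveZ; exact: is_deriveM.
have [|c ct] := mean_value (f := fun s => y s * e s)
  (f' := fun s => (y' s + v * s * y s) * e s) _ 0 t.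
  move=> s; have -> : (y' s + v * s * y s) * e s =
    y s *: (e s * (v * s)) + e s *: y' s by rewrite /GRing.scale /=; ring.
  exact: is_deriveM.
rewrite !subr0 {2}/e expr0n /= mulr0 mul0r expR0 mulr1 => yE.
have -> : y t - y 0 * expR (- (v * t ^+ 2 / 2)) =
    (y t * e t - y 0) * expR (- (v * t ^+ 2 / 2)).
  by rewrite mulrBl /e -[X in _ = X - _]mulrA -expRD subrr expR0 mulr1.
rewrite yE !normrM [X in _ * X]ger0_norm ?expR_ge0 //.
rewrite !subr0 in ct.
have ct2 : c ^+ 2 <= t ^+ 2.
  rewrite -[leLHS]real_normK ?num_real // -[leRHS]real_normK ?num_real //.
  by rewrite lerXn2r ?nnegrE.
have : e c * expR (- (v * t ^+ 2 / 2)) <= 1.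
  rewrite /e -expRD -[leRHS]expR0 ler_expR subr_le0.
  by rewrite ler_wpM2r ?invr_ge0 // ler_wpM2l.
move=> e1.
have -> : `|y' c + v * c * y c| * `|e c| * `|t| * expR (- (v * t ^+ 2 / 2)) =
    `|y' c + v * c * y c| * (e c * expR (- (v * t ^+ 2 / 2))) * `|t|.
  by rewrite (@ger0_norm _ (e c)) ?expR_ge0 //; ring.
apply: le_trans (_ : (k * t ^+ 2) * 1 * `|t| <= _); last first.
  by rewrite mulr1 (exprSr _ 2) real_normK ?num_real // -mulrA.
rewrite ler_wpM2r // ler_pM ?mulr_ge0 ?expR_ge0 //.
by apply: le_trans (ode c) _; rewrite ler_wpM2l.
Qed.

End calculus.

(** Applied to a sine, Stein's identity says that the characteristic function
    of [W] nearly solves the differential equation of the Gaussian one.  The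
    phase [th] treats the real and imaginary parts together. *)
Lemma avg_cos_estimate (R : realType) (I : finType) (phi : I -> {perm I} -> R)
    (S : I -> {set I}) (K : nat) (M : R)
    (phi_dep : forall i, depends_on (S i) (phi i))
    (cardS : forall i, (#|S i| <= K)%N)
    (cardS' : forall a, (#|[set i | a \in S i]%SET| <= K)%N)
    (phi_bd : forall i sigma, `|phi i sigma| <= M)
    (I_gt0 : (0 < #|I|)%N) (t th : R) (W := normalized_sum phi) :
  `|avg (fun s => cos (t * W s + th)) -
    cos th * expR (- (avg (fun s => W s ^+ 2) * t ^+ 2 / 2))|
  <= stein_const K M / Num.sqrt #|I|%:R * `|t| ^+ 3.
Proof.
pose v := avg (fun s => W s ^+ 2); rewrite -/v; pose y t := avg (fun s => cos (t * W s + th)).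
pose y' t := - avg (fun s => W s * sin (t * W s + th)).
have := @gaussian_ode R y y' v (stein_const K M / Num.sqrt #|I|%:R) _ _ _ _ t.
have -> : y 0 = cos th.
  rewrite /y -[RHS](avg_cst (card_perm_gt0 I)); apply: eq_avg => s.
  by rewrite mul0r add0r.
apply.
- by apply: avg_ge0 => s; rewrite sqr_ge0.
- have := stein_estimate phi_dep cardS cardS' phi_bd I_gt0 (h := fun=> 0)
    (h' := fun=> 0) (C := 1) ler01 _ _.
  rewrite mul1r => H; apply: le_trans (H _ _) => // a b.
    by rewrite mulr0 !subr0 normr0 mul1r sqr_ge0.
  by rewrite subr0 normr0 mulr_ge0.
- move=> s; rewrite /y' /y -avgN avgE; under eq_fun do rewrite avgE mulrC.
  rewrite [_ / _]mulrC; apply: is_deriveZ; apply: is_derive_bigsum => i.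
  exact: is_derive_cos_affine.
- move=> s.
  have := stein_estimate phi_dep cardS cardS' phi_bd I_gt0
    (h := fun w => sin (s * w + th)) (h' := fun w => s * cos (s * w + th))
    (sqr_ge0 s) (sin_affine_taylor s th) (cos_affine_lipschitz s th).
  rewrite -[X in _ - X * _]/v avgZ -normrN opprB.
  rewrite /y' /y addrC mulrA; congr (_ <= _).
  ring.
Qed.

(** * Asymptotics of drawing without replacement *)
Section draw_asymptotics.
Variable R : realType.
Implicit Types (x : nat -> R) (e : R) (u w : seq nat).

Definition draw_ratio x e w a : R :=
  (x a - (count_mem a w)%:R * e) / (1 - (size w)%:R * e).

(** [(draw_ratio x e (u ++ w) a - draw_ratio x e u a) / e], in a form that makes
    sense for [e = 0]; likewise [draw_defect] is the difference quotient of
    [draw_defectE]. *)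
Definition draw_ratio_defect x e w u a : R :=
  ((size w)%:R * (x a - (count_mem a u)%:R * e)
   - (count_mem a w)%:R * (1 - (size u)%:R * e)) /
  ((1 - (size (u ++ w))%:R * e) * (1 - (size u)%:R * e)).

Fixpoint draw_defect x e w u : R :=
  if u is a :: u' then
    draw_defect x e w u' * draw_ratio x e (u' ++ w) a +
    draw_prob x e u' * draw_prob x e w * draw_ratio_defect x e w u' a
  else 0.

Lemma draw_defectE x e w u : 0 <= e -> (size (u ++ w))%:R * e < 1 ->
  draw_prob x e (u ++ w) - draw_prob x e u * draw_prob x e w =
  e * draw_defect x e w u.
Proof.
move=> e0; elim: u => [|a u IH] /= uw; first by rewrite mul1r subrr mulr0.
have uw' : (size (u ++ w))%:R * e < 1.
  by apply: le_lt_trans uw; rewrite ler_wpM2r // ler_nat.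
have u' : (size u)%:R * e < 1.
  by apply: le_lt_trans uw'; rewrite ler_wpM2r // ler_nat size_cat leq_addr.
have -> : draw_prob x e (u ++ w) =
    draw_prob x e u * draw_prob x e w + e * draw_defect x e w u.
  by rewrite -IH // addrC subrK.
rewrite /draw_ratio_defect /draw_ratio.
have n1 : 1 - (size (u ++ w))%:R * e != 0 by rewrite gt_eqF // subr_gt0.
have n2 : 1 - (size u)%:R * e != 0 by rewrite gt_eqF // subr_gt0.
move: n1 n2; rewrite count_cat size_cat !natrD => n1 n2.
by field; rewrite n2 n1.
Qed.

Variables (p : nat -> R) (x_ : nat -> nat -> R) (e_ : nat -> R).
Hypotheses (x_cvg : forall a, x_ k a @[k --> \oo] --> p a)
  (e_cvg : e_ k @[k --> \oo] --> 0).

Definition letter_prod w : R := \prod_(a <- w) p a.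

Let cz (c : R) : c * e_ k @[k --> \oo] --> 0.
Proof. by rewrite -(mulr0 c); apply: cvgM => //; exact: cvg_cst. Qed.

Let c1 (c : R) : 1 - c * e_ k @[k --> \oo] --> (1 : R).
Proof.
rewrite -[X in _ --> X]subr0; apply: cvgB; [exact: cvg_cst | exact: cz].
Qed.

Let cx (c : R) a : x_ k a - c * e_ k @[k --> \oo] --> p a.
Proof. by rewrite -[p a]subr0; apply: cvgB; [exact: x_cvg | exact: cz]. Qed.

Lemma cvg_draw_ratio w a : draw_ratio (x_ k) (e_ k) w a @[k --> \oo] --> p a.
Proof.
rewrite -[p a]divr1; apply: cvgM; first exact: cx.
by apply: cvgV; [exact: oner_neq0 | exact: c1].
Qed.

Lemma cvg_draw_prob w :
  draw_prob (x_ k) (e_ k) w @[k --> \oo] --> letter_prod w.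
Proof.
elim: w => [|a w IH]; first by rewrite /letter_prod big_nil; exact: cvg_cst.
rewrite /letter_prod big_cons mulrC.
by apply: cvgM => //; exact: cvg_draw_ratio.
Qed.

Lemma cvg_draw_ratio_defect w u a :
  draw_ratio_defect (x_ k) (e_ k) w u a @[k --> \oo] -->
  (size w)%:R * p a - (count_mem a w)%:R.
Proof.
rewrite -[X in _ --> X]divr1; apply: cvgM; last first.
  apply: cvgV; first exact: oner_neq0.
  have := cvgM (c1 (size (u ++ w))%:R) (c1 (size u)%:R).
  by rewrite mulr1; apply.
apply: cvgB; first by apply: cvgM; [exact: cvg_cst | exact: cx].
by rewrite -[X in _ --> X]mulr1; apply: cvgM; [exact: cvg_cst | exact: c1].
Qed.

(** Limit of the covariance of disjoint occurrences of [u] and [w], times the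
    number of places.  When [p a = 0] for a letter [a] of [u] the value is [0];
    so is the limit, because [letter_prod w = 0] if [a] also occurs in [w]. *)
Definition letter_corr w u : R :=
  letter_prod u * letter_prod w *
  ((size u)%:R * (size w)%:R - \sum_(a <- u) (count_mem a w)%:R / p a).

Lemma letter_prod0 a w : p a = 0 -> a \in w -> letter_prod w = 0.
Proof.
move=> pa; elim: w => // b w IH; rewrite inE /letter_prod big_cons.
by case/predU1P => [<-|/IH]; rewrite ?pa ?mul0r // /letter_prod => ->; rewrite mulr0.
Qed.

(** The recursion of [draw_defect] in the limit. *)
Lemma letter_corr_cons w a u : letter_corr w (a :: u) =
  letter_corr w u * p a +
  letter_prod u * letter_prod w * ((size w)%:R * p a - (count_mem a w)%:R).
Proof.
rewrite /letter_corr big_cons {1}/letter_prod big_cons -/(letter_prod u) /=.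
have [pa|pa] := eqVneq (p a) 0; last by rewrite -natr1; field.
have : letter_prod w * (count_mem a w)%:R = 0.
  have [aw|aw] := boolP (a \in w); first by rewrite (letter_prod0 pa aw) mul0r.
  by rewrite (count_memPn aw) mulr0.
by rewrite pa !mul0r !mulr0 !add0r -mulrA mulrN => ->; rewrite oppr0 mulr0.
Qed.

Lemma cvg_draw_defect w u :
  draw_defect (x_ k) (e_ k) w u @[k --> \oo] --> letter_corr w u.
Proof.
elim: u => [|a u IH].
  by rewrite /letter_corr big_nil mul0r subrr mulr0; exact: cvg_cst.
rewrite letter_corr_cons; apply: cvgD; apply: cvgM => //.
- exact: cvg_draw_ratio.
- by apply: cvgM; exact: cvg_draw_prob.
- exact: cvg_draw_ratio_defect.
Qed.

End draw_asymptotics.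

(** * Mean and variance of a pattern count in an arrangement *)
Section cyclic_pattern_statistic.
Variables (R : realType) (N : nat) (y : N.-tuple nat).
Variables (f : plane_tree -> R) (supp : seq plane_tree) (K : nat).
Hypotheses (suppK : forall T, T \in supp -> (size (word T) <= K)%N)
  (N_gt0 : (0 < N)%N).
Implicit Type sigma : {perm 'I_N}.
Local Notation arr := (arrangement y).
Local Notation q := (draw_prob (freq R y) N%:R^-1).
Local Notation pv := (pattern_value supp f).

Definition site_value (i : 'I_N) sigma : R := pv (rot i (arr sigma)).

(** The [K] places read cyclically from [i] on. *)
Definition window (i : 'I_N) : {set 'I_N} :=
  ((cyclic_shift N ^+ i)%g @: [set j : 'I_N | (j < K)%N])%SET.

Lemma pattern_value_take x x' : take K x = take K x' -> pv x = pv x'.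
Proof.
move=> xx'; rewrite /pattern_value !big_seq; apply: eq_bigr => T /suppK TK.
by rewrite !prefixE -(take_takel x TK) -(take_takel x' TK) xx'.
Qed.

Lemma site_value_depends i : depends_on (window i) (site_value i).
Proof.
move=> s s' ss'; rewrite /site_value -!arrangement_shift ?(ltnW (ltn_ord i)) //.
apply: pattern_value_take; apply: (@eq_from_nth _ 0%N).
  by rewrite !size_take !size_arrangement.
move=> j; rewrite size_take_min size_arrangement leq_min => /andP[jK jN].
rewrite !nth_take // !(nth_arrangement _ _ (Ordinal jN)) !permM ss' //.
by apply/imsetP; exists (Ordinal jN); rewrite ?inE.
Qed.

Lemma card_ord_lt : (#|[set j : 'I_N | (j < K)%N]%SET| <= K)%N.
Proof.
have := uniq_leq_size (s1 := map val (enum [set j : 'I_N | (j < K)%N]%SET))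
  (s2 := iota 0 K).
rewrite size_map size_iota -cardE; apply.
  by rewrite map_inj_uniq ?enum_uniq //; exact: val_inj.
by move=> j /mapP[i]; rewrite mem_enum inE mem_iota => iK ->.
Qed.

Lemma card_window i : (#|window i| <= K)%N.
Proof. by rewrite card_imset ?card_ord_lt //; exact: perm_inj. Qed.

(** The place of [a] in the window of [i] determines [i]. *)
Lemma card_window_mem a : (#|[set i | a \in window i]%SET| <= K)%N.
Proof.
pose g (i : 'I_N) := ((cyclic_shift N ^+ i)^-1)%g a.
have g_inj : injective g.
  move=> i i' gii'; have aE (j : 'I_N) : a = ((j + g j) %% N)%N :> nat.
    by rewrite -cyclic_shiftX permKV.
  have /eqP := etrans (esym (aE i)) (aE i'); rewrite gii'.
  rewrite eqn_modDr !modn_small // => /eqP ii'; exact/val_inj.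
apply: leq_trans card_ord_lt; rewrite -(card_imset _ g_inj); apply: subset_leq_card.
apply/fintype.subsetP => j /imsetP[i]; rewrite inE => /imsetP[j' j'K aE] ->.
by rewrite /g aE permK.
Qed.

Definition value_bound : R := \sum_(T <- supp) `|f T|.

Lemma site_value_le i sigma : `|site_value i sigma| <= value_bound.
Proof.
apply: le_trans (ler_norm_sum _ _ _) _; apply: ler_sum => T _.
by rewrite normrM ler_piMr // normr_nat lern1 leq_b1.
Qed.

Local Notation U := (fun s => rot_sum pv (arr s)).

Lemma local_sum_site_value sigma : local_sum site_value sigma = U sigma.
Proof. by rewrite /rot_sum size_arrangement. Qed.

Lemma avg_rot_sum : (K <= N)%N ->
  avg U = N%:R * \sum_(T <- supp) f T * q (word T).
Proof.
move=> KN; rewrite [LHS](eq_avg (h := fun s => \sum_(i < N) pv (rot i (arr s)))); last first.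
  by move=> s; rewrite /rot_sum size_arrangement.
rewrite avg_sum (eq_bigr (fun=> \sum_(T <- supp) f T * q (word T))); last first.
  move=> i _; rewrite (avg_rot y pv (ltnW (ltn_ord i))) avg_sum.
  rewrite !big_seq; apply: eq_bigr => T /suppK TK.
  by rewrite avgZ avg_prefix // (leq_trans TK).
by rewrite sumr_const card_ord mulr_natl.
Qed.

Lemma avg_rot_sum_sqr : avg (fun s => U s ^+ 2) =
  N%:R * \sum_(T <- supp) \sum_(T' <- supp) f T * f T' *
    \sum_(j < N) pair_avg R y j T T'.
Proof.
pose G x := pv x * rot_sum pv x.
have -> : avg (fun s => U s ^+ 2) = \sum_(i < N) avg (fun s => G (rot i (arr s))).
  rewrite -avg_sum; apply: eq_avg => s; rewrite expr2 {1}/rot_sum.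
  by rewrite size_arrangement mulr_suml; apply: eq_bigr => i _; rewrite /G rot_sum_rot.
under eq_bigr => i _ do rewrite avg_rot ?(ltnW (ltn_ord i)) //.
rewrite sumr_const card_ord -[LHS]mulr_natl; congr (_ * _).
have -> : avg (fun s => G (arr s)) = avg (fun s => \sum_(T <- supp) \sum_(T' <- supp)
   \sum_(j < N) f T * f T' * ((prefix (word T) (arr s))%:R * (prefix (word T') (rot j (arr s)))%:R)).
  apply: eq_avg => s; rewrite /G {1}/pattern_value mulr_suml; apply: eq_bigr => T _.
  rewrite /rot_sum size_arrangement mulr_sumr [RHS]exchange_big; apply: eq_bigr => j _.
  by rewrite /pattern_value mulr_sumr; apply: eq_bigr => T' _; ring.
rewrite avg_sum; apply: eq_bigr => T _; rewrite avg_sum; apply: eq_bigr => T' _.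
rewrite avg_sum mulr_sumr; apply: eq_bigr => j _.
by rewrite avgZ.
Qed.

Local Notation W := (normalized_sum site_value).

Lemma avg_normalized_sqr :
  avg (fun s => W s ^+ 2) = (avg (fun s => U s ^+ 2) - avg U ^+ 2) / N%:R.
Proof.
have -> : avg (fun s => W s ^+ 2) = avg (fun s =>
    (U s ^+ 2 - 2 * avg U * U s + avg U ^+ 2) / N%:R).
  apply: eq_avg => s; rewrite /normalized_sum card_ord exprMn exprVn sqr_sqrtr //.
  rewrite local_sum_site_value (eq_avg local_sum_site_value); congr (_ / _).
  ring.
rewrite avgZr avgD avgB avgZ avg_cst ?card_perm_gt0 //; congr (_ / _).
ring.
Qed.

(** The variance of the count divided by [N], after the pairs of disjoint
    windows have been cancelled against the square of the mean. *)
Definition pattern_variance (x : nat -> R) (e : R) : R :=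
  \sum_(T <- supp) \sum_(T' <- supp) f T * f T' *
    ((count_mem T' (subtrees T))%:R * draw_prob x e (word T) +
     ((count_mem T (subtrees T'))%:R - (T == T')%:R) * draw_prob x e (word T') +
     (1 - (size (word T))%:R - (size (word T'))%:R) *
       draw_prob x e (word T ++ word T') +
     draw_defect x e (word T') (word T)).

Lemma avg_normalized_sqrE : (K + K < N)%N ->
  avg (fun s => W s ^+ 2) = pattern_variance (freq R y) N%:R^-1.
Proof.
move=> KN; rewrite avg_normalized_sqr avg_rot_sum_sqr avg_rot_sum; last by lia.
have N0 : N%:R != 0 :> R by rewrite pnatr_eq0 -lt0n.
rewrite exprMn expr2 -mulrA -mulrBr mulrC mulKf //.
rewrite expr2 mulr_suml mulr_sumr -sumrB /pattern_variance.
rewrite [LHS]big_seq [RHS]big_seq; apply: eq_bigr => T Ts.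
rewrite !mulr_sumr -sumrB [LHS]big_seq [RHS]big_seq; apply: eq_bigr => T' T's.
have TK := suppK Ts; have T'K := suppK T's.
rewrite sum_pair_avg; last by lia.
have qq : q (word T ++ word T') = q (word T) * q (word T') +
    N%:R^-1 * draw_defect (freq R y) N%:R^-1 (word T') (word T).
  rewrite -draw_defectE ?invr_ge0 ?ler0n //; first by rewrite addrC subrK.
  by rewrite ltr_pdivrMr ?ltr0n // mul1r ltr_nat size_cat; lia.
by rewrite qq; field.
Qed.

End cyclic_pattern_statistic.

(** * Bernstein approximation *)
Section bernstein.
Variable R : realType.
Implicit Types (h : nat -> R) (s : R) (H : R -> R).

(** Expectation of [h] of a binomial variable with parameters [n] and [s],
    by conditioning on the first trial. *)
Fixpoint bernstein n h s : R :=
  if n is n'.+1 then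
    s * bernstein n' (fun k => h k.+1) s + (1 - s) * bernstein n' h s
  else h 0%N.

Lemma bernstein_le n h h' s : 0 <= s <= 1 -> (forall k, (k <= n)%N -> h k <= h' k) ->
  bernstein n h s <= bernstein n h' s.
Proof.
move=> /andP[s0 s1]; elim: n h h' => [|n IH] h h' hh' /=; first exact: hh'.
apply: lerD; apply: ler_wpM2l; rewrite ?subr_ge0 //; apply: IH => k kn.
  exact: hh'.
by apply: hh'; exact: leqW.
Qed.

Lemma bernstein_cst n c s : bernstein n (fun=> c) s = c.
Proof. by elim: n => //= n ->; ring. Qed.

Lemma bernsteinD n h h' s :
  bernstein n (fun k => h k + h' k) s = bernstein n h s + bernstein n h' s.
Proof. by elim: n h h' => //= n IH h h'; rewrite !IH; ring. Qed.

Lemma bernsteinZ n c h s : bernstein n (fun k => c * h k) s = c * bernstein n h s.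
Proof. by elim: n h => //= n IH h; rewrite !IH; ring. Qed.

(** The variance of a binomial variable, with a free centre [a] to let the
    induction go through. *)
Lemma bernstein_sqr n a s :
  bernstein n (fun k => (k%:R - a) ^+ 2) s = n%:R * (s * (1 - s)) + (n%:R * s - a) ^+ 2.
Proof.
elim: n a => [|n IH] a /=; first by ring.
rewrite IH (_ : (fun k => _) = (fun k => (k%:R - (a - 1)) ^+ 2)); last first.
  by apply/funext => k; rewrite -natr1; congr (_ ^+ 2); ring.
by rewrite IH -natr1; ring.
Qed.

(** Heine's theorem, with the second point free to leave the interval. *)
Lemma uniform_continuity H a b : continuous H -> forall e : R, 0 < e ->
  exists2 d, 0 < d & forall s t, s \in `[a, b] -> `|t - s| < d -> `|H t - H s| <= e.
Proof.
move=> cH e e0.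
have /compact_near_coveringP/(_ _ (0 : R)^'+
   (fun d s => forall t, `|t - s| < d -> `|H t - H s| <= e)) := @segment_compact R a b.
case=> [s _|d /= d0 dP].
  have /cvgrPdist_le/(_ (e / 2)) := cH s.
  rewrite divr_gt0 // => /(_ isT)[r /= r0 rP].
  exists (ball s (r / 2), [set d | d < r / 2]) => /=.
    split; first by apply: nbhsx_ballx; rewrite divr_gt0.
    by apply: nbhs_right_lt; rewrite divr_gt0.
  move=> [s' d] /= [ss' dr] t ts'.
  have -> : H t - H s' = (H s - H s') - (H s - H t) by ring.
  rewrite [e]splitr; apply: le_trans (ler_normB _ _) _.
  rewrite /ball /= in ss'; apply: lerD; apply: rP; rewrite /ball_ /=.
    by apply: lt_le_trans ss' _; lra.
  have -> : s - t = (s - s') - (t - s') by ring.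
  by apply: le_lt_trans (ler_normB _ _) _; lra.
have d2 : 0 < d / 2 by rewrite divr_gt0.
exists (d / 2) => // s t sab; apply: (dP (d / 2)) => //=.
by rewrite sub0r normrN gtr0_norm //; lra.
Qed.

(** Bernstein's proof: [H] differs from its value at [s] by at most [e / 2] near
    [s], and by a multiple of [(k / n - s)^2] elsewhere. *)
Lemma bernstein_approx H (M : R) : continuous H -> (forall x, `|H x| <= M) ->
  forall e : R, 0 < e -> exists n, forall s, 0 <= s <= 1 ->
    `|H s - bernstein n (fun k => H (k%:R / n%:R)) s| <= e.
Proof.
move=> cH HM e e0.
have M0 : 0 <= M by apply: le_trans (HM 0).
have [d d0 dP] := @uniform_continuity H 0 1 cH (e / 2) (divr_gt0 e0 (ltr0Sn _ 1)).
pose C := (M + M) / d ^+ 2.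
have C0 : 0 <= C by rewrite mulr_ge0 ?addr_ge0 ?invr_ge0 ?sqr_ge0.
(* Large enough for the variance term [C / n] to be at most [e / 2]. *)
pose n := (Num.truncn (2 * C / e)).+1.
have nC : C <= n%:R * (e / 2).
  rewrite mulrA ler_pdivlMr // mulrC -ler_pdivrMr //.
  by apply/ltW; rewrite /n; exact: truncnS_gt.
exists n => s s01; have /andP[s0 s1] := s01.
have n0 : 0 < n%:R :> R by rewrite ltr0n.
have key k : `|H s - H (k%:R / n%:R)| <=
    e / 2 + C / n%:R ^+ 2 * (k%:R - n%:R * s) ^+ 2.
  have kE : k%:R - n%:R * s = n%:R * (k%:R / n%:R - s) by field; rewrite gt_eqF.
  have -> : C / n%:R ^+ 2 * (k%:R - n%:R * s) ^+ 2 = C * (k%:R / n%:R - s) ^+ 2.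
    by rewrite kE; field; rewrite gt_eqF.
  have [near_s|far_s] := ltP `|k%:R / n%:R - s| d.
    rewrite distrC; apply: le_trans (dP s _ _ near_s) _; first by rewrite in_itv.
    by rewrite lerDl mulr_ge0 ?sqr_ge0.
  apply: le_trans (ler_normB _ _) _.
  apply: le_trans (lerD (HM _) (HM _)) _.
  apply: le_trans (_ : C * (k%:R / n%:R - s) ^+ 2 <= _); last first.
    by rewrite lerDr divr_ge0 // ltW.
  rewrite /C mulrAC ler_pdivlMr ?exprn_gt0 // ler_wpM2l ?addr_ge0 //.
  rewrite -[leRHS]real_normK ?num_real // lerXn2r ?nnegrE // ltW //.
have bound : bernstein n (fun k => e / 2 + C / n%:R ^+ 2 * (k%:R - n%:R * s) ^+ 2) s <= e.
  rewrite bernsteinD bernstein_cst bernsteinZ bernstein_sqr subrr expr0n addr0.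
  rewrite [leRHS]splitr lerD2l.
  have -> : C / n%:R ^+ 2 * (n%:R * (s * (1 - s))) = C * (s * (1 - s)) / n%:R.
    by field; rewrite gt_eqF.
  rewrite ler_pdivrMr // mulrC [leRHS]mulrC; apply: le_trans nC.
  rewrite mulrC ler_piMr // mulr_ile1 ?subr_ge0 //.
  by rewrite lerBlDr lerDl.
rewrite ler_norml; apply/andP; split.
  rewrite lerBrDr -lerBrDl opprK; apply: le_trans (lerD (lexx (H s)) bound).
  rewrite -[X in X + _](bernstein_cst n (H s) s) -bernsteinD.
  apply: bernstein_le => // k _; rewrite -lerBlDl.
  by apply: le_trans (key k); rewrite distrC ler_norm.
rewrite lerBlDr -lerBlDl; apply: le_trans (_ : H s - bernstein n _ s <= _).
  exact: (lerB (lexx (H s)) bound).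
rewrite -[X in X - _](bernstein_cst n (H s) s) -mulN1r -bernsteinZ -bernsteinD.
apply: bernstein_le => // k _; rewrite mulN1r lerBlDr -lerBlDl.
by apply: le_trans (key k); rewrite ler_norm.
Qed.

End bernstein.

(** * Approximation by trigonometric polynomials *)
Section trigonometric_approximation.
Variable R : realType.

Inductive trig_poly : (R -> R) -> Prop :=
| trig_cos t th : trig_poly (fun x => cos (t * x + th))
| trig_add u v : trig_poly u -> trig_poly v -> trig_poly (fun x => u x + v x)
| trig_scale a u : trig_poly u -> trig_poly (fun x => a * u x).

Lemma trig_mul_cos t th u : trig_poly u -> trig_poly (fun x => cos (t * x + th) * u x).
Proof.
elim=> {u} [t' th'|u v _ IHu _ IHv|a u _ IHu].
- have -> : (fun x => cos (t * x + th) * cos (t' * x + th')) =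
      fun x => 2^-1 * (cos ((t + t') * x + (th + th')) + cos ((t - t') * x + (th - th'))).
    apply/funext => x.
    have -> : (t + t') * x + (th + th') = (t * x + th) + (t' * x + th') by ring.
    have -> : (t - t') * x + (th - th') = (t * x + th) - (t' * x + th') by ring.
    by rewrite (cosD (t * x + th)) (cosB (t * x + th)); field.
  by apply: trig_scale; apply: trig_add; exact: trig_cos.
- have -> : (fun x => cos (t * x + th) * (u x + v x)) =
      fun x => cos (t * x + th) * u x + cos (t * x + th) * v x.
    by apply/funext => x; ring.
  exact: trig_add.
- have -> : (fun x => cos (t * x + th) * (a * u x)) =
      fun x => a * (cos (t * x + th) * u x).
    by apply/funext => x; ring.
  exact: trig_scale.
Qed.

Definition half_sine (c x : R) : R := (1 + sin (c * x)) / 2.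

Lemma half_sine01 c x : 0 <= half_sine c x <= 1.
Proof.
have /andP[s1 s2] : -1 <= sin (c * x) <= 1 by rewrite -ler_norml sin_max.
by rewrite /half_sine; lra.
Qed.

(** Trigonometric polynomials are stable under multiplication by
    [sin (c x) = cos (c x - pi / 2)]. *)
Lemma trig_bernstein n (h : nat -> R) c :
  trig_poly (fun x => bernstein n h (half_sine c x)).
Proof.
elim: n h => [|n IH] h /=.
  have -> : (fun=> h 0%N) = (fun x : R => h 0%N * cos (0 * x + 0)).
    by apply/funext => x; rewrite mul0r addr0 cos0 mulr1.
  exact/trig_scale/trig_cos.
set u := fun x => bernstein n (fun k => h k.+1) (half_sine c x).
set v := fun x => bernstein n h (half_sine c x).
have -> : (fun x => half_sine c x * bernstein n (fun k => h k.+1) (half_sine c x) +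
    (1 - half_sine c x) * bernstein n h (half_sine c x)) =
  fun x => 2^-1 * (u x + cos (c * x + - (pi / 2)) * u x) +
    2^-1 * (v x + -1 * (cos (c * x + - (pi / 2)) * v x)).
  by apply/funext => x; rewrite cosBpihalf /half_sine /u /v; field.
apply: trig_add; apply: trig_scale; apply: trig_add; rewrite ?/u ?/v //.
  exact: trig_mul_cos.
exact/trig_scale/trig_mul_cos.
Qed.

Lemma trig_poly_continuous u : trig_poly u -> continuous u.
Proof.
elim=> {u} [t th|u v _ IHu _ IHv|a u _ IHu] x.
- apply: (@continuous_comp _ _ _ (fun x => t * x + th) cos); last exact: continuous_cos.
  apply: cvgD; last exact: cvg_cst.
  by apply: cvgM; [exact: cvg_cst | exact: cvg_id].
- exact: (cvgD (IHu x) (IHv x)).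
- by apply: cvgM; [exact: cvg_cst | exact: IHu].
Qed.

(** With [c = 1 / (2 L)] the function [sin (c x)] is one-to-one on [[-L, L]], so
    that [g] there is a continuous function of it, to which Bernstein's
    approximation applies.  The approximant is a trigonometric polynomial,
    bounded on the whole line. *)
Lemma trig_poly_approx (g : R -> R) (M L e : R) : continuous g ->
  (forall x, `|g x| <= M) -> 0 < L -> 0 < e ->
  exists2 u, trig_poly u & (forall x, `|u x| <= M) /\
    (forall x, `|x| <= L -> `|g x - u x| <= e).
Proof.
move=> cg gM L0 e0.
have pi1 : 1 <= pi / 2 :> R := pihalf_ge1 R.
have ler_sin : {in `[- (pi / 2), pi / 2] &, {mono (@sin R) : x y / x <= y}}.
  by apply: le_mono_in => x y xI yI xy; rewrite ltr_sin.
pose r : R := sin 2^-1.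
have r1 : r < 1.
  by rewrite -sin_pihalf ltr_sin ?in_itv /=; lra.
have rN : -1 < - r by rewrite ltrN2.
have r0 : - r <= r.
  by rewrite -sinN ler_sin ?in_itv /=; lra.
pose c := (2 * L)^-1.
have c0 : c != 0 by rewrite invr_eq0 gt_eqF ?mulr_gt0.
(* Clamping to [[-r, r]] keeps away from the end points of the domain of
   [asin]. *)
pose clamp (s : R) : R := Num.max (- r) (Num.min r s).
have clampP s : - r <= clamp s <= r.
  by rewrite /clamp le_max lexx /= ge_max r0 ge_min lexx.
pose H s := g (c^-1 * asin (clamp (2 * s - 1))).
have cH : continuous H.
  move=> s; apply: (@continuous_comp _ _ _ (fun s : R => c^-1 * asin (clamp (2 * s - 1))) g s); last exact: cg.
  apply: cvgM; first exact: cvg_cst.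
  apply: (@continuous_comp _ _ _ (fun s : R => clamp (2 * s - 1)) (@asin R) s); last first.
    apply: continuous_asin; have /andP[c1 c2] := clampP (2 * s - 1).
    by rewrite (lt_le_trans rN c1) (le_lt_trans c2 r1).
  apply: continuous_max; first exact: cvg_cst.
  apply: continuous_min; first exact: cvg_cst.
  apply: cvgB; last exact: cvg_cst.
  by apply: cvgM; [exact: cvg_cst | exact: cvg_id].
have [n nP] := bernstein_approx cH (fun s => gM _) e0.
exists (fun x => bernstein n (fun k => H (k%:R / n%:R)) (half_sine c x)).
  exact: trig_bernstein.
split=> x.
  have s01 := half_sine01 c x; rewrite ler_norml; apply/andP; split.
    rewrite -(bernstein_cst n (- M) (half_sine c x)); apply: bernstein_le => // k _.
    by have := gM (c^-1 * asin (clamp (2 * (k%:R / n%:R) - 1))); rewrite ler_norml => /andP[].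
  rewrite -[leRHS](bernstein_cst n M (half_sine c x)); apply: bernstein_le => // k _.
  by have := gM (c^-1 * asin (clamp (2 * (k%:R / n%:R) - 1))); rewrite ler_norml => /andP[].
move=> xL; have -> : g x = H (half_sine c x); last exact/nP/half_sine01.
have /andP[x1 x2] : - 2^-1 <= c * x <= 2^-1.
  have cE : `|c| = (2 * L)^-1 by rewrite gtr0_norm // invr_gt0 mulr_gt0.
  rewrite -ler_norml normrM cE mulrC ler_pdivrMr ?mulr_gt0 //.
  by rewrite mulrA mulVf // mul1r.
rewrite /H /half_sine; have -> : 2 * ((1 + sin (c * x)) / 2) - 1 = sin (c * x) by field.
have -> : clamp (sin (c * x)) = sin (c * x).
  rewrite /clamp min_r ?max_r //.
    by rewrite -sinN ler_sin ?in_itv /=; lra.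
  by rewrite ler_sin ?in_itv /=; lra.
rewrite sinK ?in_itv /=; last by lra.
by rewrite mulKf.
Qed.

End trigonometric_approximation.

(** * From characteristic functions to weak convergence *)
Section weak_convergence.
Variables (R : realType) (mu : probability (measurableTypeR R) R).

Lemma integrable_continuous_bounded (g : R -> R) (M : R) : continuous g ->
  (forall x, `|g x| <= M) -> mu.-integrable setT (EFin \o g).
Proof.
move=> cg gM; apply: measurable_bounded_integrable => //.
- by apply: le_lt_trans (probability_le1 mu _) _; rewrite ?ltry.
- exact: continuous_measurable_fun.
- exists M; split; first by rewrite num_real.
  by move=> K MK x _ /=; apply: le_trans (gM x) (ltW MK).
Qed.

Lemma measurable_normr_gt (L : R) :
  measurable ([set x | (L < `|x|)%R] : set (measurableTypeR R)).
Proof.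
rewrite (_ : [set x | _] = (fun x : R => `|x|) @^-1` `]L, +oo[%classic); last first.
  by apply/seteqP; split => x /=; rewrite in_itv /= andbT.
by rewrite -[X in measurable X]setTI; exact: normr_measurable.
Qed.

Lemma probability_tight (e : R) : 0 < e ->
  exists2 L : R, 0 < L & (mu [set x | (L < `|x|)%R] <= e%:E)%E.
Proof.
move=> e0; pose A n : set R := [set x | (n%:R < `|x|)%R].
have mA n : measurable (A n) := measurable_normr_gt n%:R.
have Adecr : nonincreasing_seq A.
  move=> n m nm; apply/subsetPset => x /=; apply: le_lt_trans.
  by rewrite ler_nat.
have A0 : \bigcap_n A n = set0.
  apply/seteqP; split => // x /(_ (Num.truncn `|x|).+1 I) /=.
  by rewrite /A /= ltNge ltW // truncnS_gt.
have := @nonincreasing_cvg_mu _ _ _ mu A _ mA _ Adecr.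
rewrite A0 measure0 => /(_ _ _)/fine_cvgP.
case=> //.
  by apply: le_lt_trans (probability_le1 mu (mA 0%N)) _; rewrite ltry.
move=> _ /cvgrPdist_le/(_ e e0)[n _ /(_ n.+1 (leqnSn n))] /=.
rewrite sub0r normrN ger0_norm ?fine_ge0 // => An.
exists n.+1%:R => //; rewrite -[X in (X <= _)%E]fineK ?lee_fin //.
by apply: fin_num_measure; exact: (mA n.+1).
Qed.

Variables (T : nat -> finType) (W : forall k, T k -> R) (C : R).
Arguments W : clear implicits.
Hypotheses (T_gt0 : forall k, (0 < #|T k|)%N)
  (W_sqr : \forall k \near \oo, avg (fun s => W k s ^+ 2) <= C)
  (cvg_cos : forall t th, avg (fun s => cos (t * W k s + th)) @[k --> \oo] -->
     \int[mu]_x cos (t * x + th)).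

Lemma cvg_trig_poly u : trig_poly u ->
  (exists M, forall x, `|u x| <= M) /\
  avg (u \o W k) @[k --> \oo] --> \int[mu]_x u x.
Proof.
elim=> {u} [t th|u v u_trig [[M uM] IHu] v_trig [[M' vM] IHv]|a u u_trig [[M uM] IHu]].
- by split; [exists 1 => x; exact: cos_max | exact: cvg_cos].
- split.
    by exists (M + M') => x; apply: le_trans (ler_normD _ _) (lerD _ _).
  rewrite RintegralD //; last 2 first.
  + exact: integrable_continuous_bounded (trig_poly_continuous u_trig) uM.
  + exact: integrable_continuous_bounded (trig_poly_continuous v_trig) vM.
  under eq_fun do rewrite avgD.
  exact: cvgD.
- split.
    by exists (`|a| * M) => x; rewrite normrM ler_wpM2l.
  rewrite RintegralZl //; last first.
    exact: integrable_continuous_bounded (trig_poly_continuous u_trig) uM.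
  under eq_fun do rewrite avgZ.
  by apply: cvgM => //; exact: cvg_cst.
Qed.

(** A form of Levy's continuity theorem: with bounded second moments no mass
    escapes, so that a test function may be replaced by a trigonometric
    polynomial close to it on a large interval. *)
Lemma cvg_avg_bounded_continuous (g : R -> R) (M : R) : continuous g ->
  (forall x, `|g x| <= M) ->
  avg (g \o W k) @[k --> \oo] --> \int[mu]_x g x.
Proof.
move=> cg gM.
have M0 : 0 <= M by apply: le_trans (gM 0).
apply/cvgrPdist_le => e e0.
(* [D] bounds the distance of [g] to the trigonometric polynomial everywhere,
   and [L] is so large that either tail contributes at most [e / 8]. *)
pose D := M + M + 1.
have D0 : 0 < D by rewrite ltr_wpDl ?addr_ge0.
have e6 : 0 < e / 8 by rewrite divr_gt0.
have [L1 L10 muL] := probability_tight (divr_gt0 e6 D0).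
pose L := Num.max L1 (Num.sqrt (`|C| * D / (e / 8)) + 1).
have L0 : 0 < L by rewrite lt_max L10.
have CL : C * D / L ^+ 2 <= e / 8.
  rewrite ler_pdivrMr ?exprn_gt0 // [leRHS]mulrC -ler_pdivrMr //.
  apply: le_trans (_ : `|C| * D / (e / 8) <= _).
    by rewrite ler_pM2r ?invr_gt0 // ler_pM2r // ler_norm.
  rewrite -[leLHS]sqr_sqrtr; last by apply: divr_ge0; [apply: mulr_ge0 => //; exact: ltW | exact: ltW].
  rewrite lerXn2r ?nnegrE ?sqrtr_ge0 ?ltW //.
  by rewrite lt_max; apply/orP; right; rewrite ltrDl.
have [u u_trig [uM uL]] := trig_poly_approx cg gM L0 e6.
have [_ /cvgrPdist_le/(_ (e / 8) e6) cu] := cvg_trig_poly u_trig.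
have cont_u := trig_poly_continuous u_trig.
have gu x : `|g x - u x| <= D.
  apply: le_trans (ler_normB _ _) _; apply: le_trans (lerD (gM x) (uM x)) _.
  by rewrite /D lerDl.
have mu_gu : `|\int[mu]_x g x - \int[mu]_x u x| <= e / 8 + e / 8.
  have ig := integrable_continuous_bounded cg gM.
  have iu := integrable_continuous_bounded cont_u uM.
  have cgu : continuous (fun x => g x - u x) by move=> x; exact: (cvgB (cg x) (cont_u x)).
  have igu := integrable_continuous_bounded cgu gu.
  rewrite -RintegralB //; apply: le_trans (le_normr_Rintegral _ _) _ => //.
  pose A : set R := [set x | (L < `|x|)%R].
  have mA : measurable A := measurable_normr_gt L.
  have iA : mu.-integrable setT (EFin \o (fun x => D * \1_A x)).
    rewrite (_ : EFin \o _ = fun x => (D%:E * (\1_A x)%:E)%E); last first.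
      by apply/funext => x /=; rewrite EFinM.
    by apply: integrableZl => //; exact: integrable_indic.
  have ie : mu.-integrable setT (EFin \o cst (e / 8)).
    exact: finite_measure_integrable_cst.
  apply: le_trans (_ : \int[mu]_x (e / 8 + D * \1_A x) <= _).
    apply: le_Rintegral => //.
    - exact: integrable_norm.
    - exact: (integrableD measurableT ie iA).
    - move=> x _; rewrite indicE; case: (boolP (x \in A)) => xA.
        by rewrite mulr1; apply: le_trans (gu x) _; rewrite lerDr ltW.
      rewrite mulr0 addr0; apply: uL; rewrite leNgt; apply/negP => xL.
      by rewrite notin_setE in xA; exact: xA.
  rewrite RintegralD // Rintegral_cst // RintegralZl //; last first.
    exact: integrable_indic.
  have mu1 : mu [set: R] = 1%E := probability_setT mu.
  rewrite [X in fine X](_ : _ = 1%E) // mulr1 lerD2l mulrC -ler_pdivlMr //.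
  rewrite /Rintegral integral_indic // setIT -lee_fin fineK; last exact: fin_num_measure.
  apply: le_trans muL; apply: le_measure; rewrite ?inE //.
    exact: measurable_normr_gt.
  by move=> x /=; apply: le_lt_trans; rewrite le_max lexx.
near=> k.
have Wk : avg (fun s => W k s ^+ 2) <= C by near: k.
have avg_gu : `|avg (g \o W k) - avg (u \o W k)| <= e / 8 + e / 8.
  rewrite -avgB; apply: le_trans (normr_avg _) _.
  apply: le_trans (_ : avg (fun s => e / 8 + D / L ^+ 2 * W k s ^+ 2) <= _).
    apply: avg_le => s /=; have [WL|WL] := leP `|W k s| L.
      apply: le_trans (uL _ WL) _; rewrite lerDl mulr_ge0 ?sqr_ge0 //.
      by rewrite divr_ge0 ?sqr_ge0 // ltW.
    apply: le_trans (gu _) _; apply: le_trans (_ : D / L ^+ 2 * W k s ^+ 2 <= _); last first.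
      by rewrite lerDr ltW.
    rewrite mulrAC ler_pdivlMr ?exprn_gt0 // ler_pM2l //.
    rewrite -[leRHS]real_normK ?num_real // lerXn2r ?nnegrE //; exact: ltW.
  rewrite avgD avgZ avg_cst // lerD2l; apply: le_trans CL.
  have -> : C * D / L ^+ 2 = D / L ^+ 2 * C by ring.
  by rewrite ler_wpM2l // divr_ge0 ?sqr_ge0 // ltW.
have cuk : `|\int[mu]_x u x - avg (u \o W k)| <= e / 8 by near: k.
have -> : \int[mu]_x g x - avg (g \o W k) =
  (\int[mu]_x g x - \int[mu]_x u x) + (\int[mu]_x u x - avg (u \o W k))
  - (avg (g \o W k) - avg (u \o W k)) by ring.
apply: le_trans (ler_normB _ _) _; apply: le_trans (lerD (ler_normD _ _) (lexx _)) _.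
apply: le_trans (lerD (lerD mu_gu cuk) avg_gu) _; lra.
Unshelve. all: end_near. Qed.

End weak_convergence.

(** * The characteristic function of the normal law *)
Section normal_characteristic_function.
Variables (R : realType) (s : R).
Hypothesis s0 : s != 0.
Local Notation mu := (@lebesgue_measure R).
Local Notation nu := (normal_prob 0 s).
Local Notation pdf := (normal_pdf 0 s).

(** The density is the Radon--Nikodym derivative, both having the same integral
    over every measurable set. *)
Lemma integral_normal_density (f : R -> R) :
  (nu : probability (measurableTypeR R) R).-integrable setT (EFin \o f) ->
  \int[nu]_x f x = \int[mu]_x (f x * pdf x).
Proof.
move=> intf; rewrite /Rintegral.
pose nu' : {finite_measure set (measurableTypeR R) -> \bar R} :=
  (nu : probability (measurableTypeR R) R).
have dom : nu' `<< mu := @normal_prob_dominates R 0 s.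
rewrite -(Radon_Nikodym_change_of_variables dom measurableT intf).
have ms2 : measurable_fun setT (EFin \o pdf).
  by apply/measurable_EFinP; exact: measurable_normal_pdf.
have rn_int := @Radon_Nikodym_integrable _ _ R (charge_of_finite_measure nu') mu dom.
congr fine; apply: ae_eq_integral => //.
- by apply: emeasurable_funM; [exact: (measurable_int _ intf) | exact: (measurable_int _ rn_int)].
- rewrite (_ : (fun x => _) = (fun x => (f x)%:E * (pdf x)%:E)%E); last first.
    by apply/funext => x; rewrite EFinM.
  by apply: emeasurable_funM; [exact: (measurable_int _ intf) | ].
- rewrite (_ : (fun x => (f x * pdf x)%:E) = (fun x => (f x)%:E * (pdf x)%:E)%E); last first.
    by apply/funext => x; rewrite EFinM.
  apply: ae_eqe_mul2l; apply: integral_ae_eq => //.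
  move=> E _ mE.
  by rewrite -(@Radon_Nikodym_integral _ _ R (charge_of_finite_measure nu') mu E dom).
Qed.

Lemma normal_pdf_is_derive (x : R) : is_derive x 1 pdf (- (x / s ^+ 2) * pdf x).
Proof.
rewrite normal_pdfE // /normal_fun.
have dsq : is_derive x 1 (fun x : R => - (x - 0) ^+ 2 / (s ^+ 2 *+ 2)) (- (x / s ^+ 2)).
  have -> : (fun x : R => - (x - 0) ^+ 2 / (s ^+ 2 *+ 2)) =
      (- (s ^+ 2 *+ 2)^-1) *: ((id : R -> R) * id).
    by apply/funext => z; rewrite !fctE subr0 /GRing.scale /=; ring.
  have -> : - (x / s ^+ 2) = (- (s ^+ 2 *+ 2)^-1) * (x * 1 + x * 1).
    by field.
  apply: is_deriveZ; exact: is_deriveM.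
have -> : - (x / s ^+ 2) * (normal_peak s * expR (- (x - 0) ^+ 2 / (s ^+ 2 *+ 2))) =
    normal_peak s * (expR (- (x - 0) ^+ 2 / (s ^+ 2 *+ 2)) * - (x / s ^+ 2)) by ring.
apply: is_deriveZ.
Qed.

(** From [1 + |x| <= 2 + x^2], bounded by a constant times [1 + u] and so by
    that constant times [expR u], where [u] is the difference of the exponents of
    the densities with deviations [2 s] and [s]. *)
Definition domination_const : R := (2 + 8 * s ^+ 2 / 3) * (normal_peak s / normal_peak (2 * s)).

Lemma normal_pdf_domination (x : R) :
  (1 + `|x|) * pdf x <= domination_const * normal_pdf 0 (2 * s) x.
Proof.
have s20 : 2 * s != 0 by rewrite mulf_neq0.
rewrite !normal_pdfE // /normal_fun subr0 /domination_const.
have p0 : normal_peak (2 * s) != 0 by rewrite gt_eqF // normal_peak_gt0.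
have sq0 : 0 < s ^+ 2 by rewrite exprn_even_gt0.
have -> : (2 + 8 * s ^+ 2 / 3) * (normal_peak s / normal_peak (2 * s)) *
    (normal_peak (2 * s) * expR (- x ^+ 2 / ((2 * s) ^+ 2 *+ 2))) =
    normal_peak s * ((2 + 8 * s ^+ 2 / 3) * expR (- x ^+ 2 / ((2 * s) ^+ 2 *+ 2))).
  by field.
rewrite mulrCA ler_wpM2l ?normal_peak_ge0 //.
pose u := 3 * x ^+ 2 / (8 * s ^+ 2).
have -> : - x ^+ 2 / ((2 * s) ^+ 2 *+ 2) = u + - x ^+ 2 / (s ^+ 2 *+ 2).
  by rewrite /u; field.
rewrite expRD mulrA ler_wpM2r ?expR_ge0 //.
apply: le_trans (_ : (2 + 8 * s ^+ 2 / 3) * (1 + u) <= _); last first.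
  rewrite ler_wpM2l ?expR_ge1Dx //.
  by rewrite addr_ge0 // divr_ge0 // mulr_ge0 // ltW.
have -> : (2 + 8 * s ^+ 2 / 3) * (1 + u) = 2 + x ^+ 2 + (2 * u + 8 * s ^+ 2 / 3).
  by rewrite /u; field.
have u0 : 0 <= u by rewrite /u divr_ge0 // mulr_ge0 // ?sqr_ge0 // ltW.
have x2 : `|x| <= 1 + x ^+ 2.
  rewrite -real_normK ?num_real //; have := sqr_ge0 (`|x| - 1); have := normr_ge0 x.
  nra.
by lra.
Qed.

Let K : R := domination_const.

Let K0 : 0 < K.
Proof.
have s20 : 2 * s != 0 by rewrite mulf_neq0.
rewrite mulr_gt0 ?divr_gt0 ?normal_peak_gt0 // ltr_wpDr //.
by rewrite divr_ge0 // mulr_ge0 // sqr_ge0.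
Qed.

Lemma integrable_mul_normal_pdf (f : R -> R) (C : R) : continuous f ->
  (forall x, `|f x| <= C * (1 + `|x|)) ->
  mu.-integrable setT (EFin \o (fun x => f x * pdf x)).
Proof.
move=> cf fC.
have i2 := @integrable_normal_pdf R 0 (2 * s).
have : mu.-integrable setT (fun x => ((C * K)%:E * (normal_pdf 0 (2 * s) x)%:E)%E).
  exact: integrableZl.
apply: le_integrable => //.
  apply/measurable_EFinP/measurable_funM; first exact: continuous_measurable_fun.
  exact: measurable_normal_pdf.
move=> x _ /=; rewrite lee_fin.
have C0 : 0 <= C.
  by have := fC 0; rewrite normr0 addr0 mulr1; apply: le_trans.
rewrite normrM [X in _ * X]ger0_norm ?normal_pdf_ge0 //.
apply: le_trans (_ : C * ((1 + `|x|) * pdf x) <= _).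
  by rewrite mulrA ler_wpM2r ?normal_pdf_ge0.
rewrite [leRHS]ger0_norm; last first.
  by apply: mulr_ge0; [apply: mulr_ge0 => //; exact: ltW | exact: normal_pdf_ge0].
by rewrite -mulrA ler_wpM2l // normal_pdf_domination.
Qed.

Lemma cvg_normal_pdf0 (f : R -> R) : (forall x, `|f x| <= 1) ->
  f n%:R * pdf n%:R @[n --> \oo] --> (0 : R) /\
  f (- n%:R) * pdf (- n%:R) @[n --> \oo] --> (0 : R).
Proof.
move=> f1.
pose C := K * normal_peak (2 * s).
have s20 : 2 * s != 0 by rewrite mulf_neq0.
have C0 : 0 < C by rewrite mulr_gt0 ?normal_peak_gt0.
have bound x : `|f x * pdf x| <= C / (1 + `|x|).
  rewrite normrM [X in _ * X]ger0_norm ?normal_pdf_ge0 //.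
  rewrite ler_pdivlMr; last by rewrite ltr_wpDr.
  apply: le_trans (_ : pdf x * (1 + `|x|) <= _).
    by rewrite ler_wpM2r ?addr_ge0 // ler_piMl ?normal_pdf_ge0.
  rewrite mulrC; apply: le_trans (normal_pdf_domination x) _.
  by rewrite ler_wpM2l ?normal_pdf_ub // ltW.
have lim0 (u : nat -> R) : (forall n, `|u n| = n%:R) ->
    f (u n) * pdf (u n) @[n --> \oo] --> (0 : R).
  move=> un; apply/norm_cvg0P.
  apply: (@squeeze_cvgr _ _ _ _ (fun=> 0) (fun n => C * (harmonic n))); last 2 first.
  - exact: cvg_cst.
  - by rewrite -(mulr0 C); apply: cvgM; [exact: cvg_cst | exact: cvg_harmonic].
  near=> n; rewrite normr_ge0 /=.
  by apply: le_trans (bound _) _; rewrite un /harmonic /= -natr1 addrC.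
by split; apply: lim0 => n; rewrite ?normrN normr_nat.
Unshelve. all: end_near. Qed.

Lemma continuous_affine_comp (g : R -> R) (t th : R) : continuous g ->
  continuous (fun x => g (t * x + th)).
Proof.
move=> cg x; apply: (@continuous_comp _ _ _ (fun x : R => t * x + th) g x); last exact: cg.
apply: cvgD; last exact: cvg_cst.
by apply: cvgM; [exact: cvg_cst | exact: cvg_id].
Qed.

Let S (t th x : R) : R := sin (t * x + th).
Let D (t th x : R) : R := t * cos (t * x + th) - x / s ^+ 2 * sin (t * x + th).

Lemma continuous_stein t th : continuous (D t th).
Proof.
move=> x; apply: cvgB; apply: cvgM.
- exact: cvg_cst.
- exact: (continuous_affine_comp (g := @cos R) (@continuous_cos R)).
- by apply: cvgM; [exact: cvg_id | exact: cvg_cst].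
- exact: (continuous_affine_comp (g := @sin R) (@continuous_sin R)).
Qed.

Lemma integrable_stein t th :
  mu.-integrable setT (EFin \o (fun x => D t th x * pdf x)).
Proof.
apply: (@integrable_mul_normal_pdf _ (`|t| + (s ^+ 2)^-1)).
  exact: continuous_stein.
move=> x; apply: le_trans (ler_normB _ _) _; rewrite !normrM.
have q0 : 0 <= (s ^+ 2)^-1 by rewrite invr_ge0 sqr_ge0.
rewrite [X in _ + _ * X * _]ger0_norm //.
have t1 : `|t| * `|cos (t * x + th)| <= `|t| by rewrite ler_piMr ?cos_max.
have t2 : `|x| * (s ^+ 2)^-1 * `|sin (t * x + th)| <= (s ^+ 2)^-1 * `|x|.
  by rewrite [leRHS]mulrC ler_piMr ?mulr_ge0 ?sin_max.
apply: le_trans (lerD t1 t2) _; rewrite mulrDl !mulrDr !mulr1.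
by have := mulr_ge0 (normr_ge0 t) (normr_ge0 x); lra.
Qed.

Lemma stein_is_derive t th (x : R) :
  is_derive x 1 (fun x => S t th x * pdf x) (D t th x * pdf x).
Proof.
have -> : D t th x * pdf x = S t th x *: (- (x / s ^+ 2) * pdf x) + pdf x *: (t * cos (x * t + th)).
  by rewrite /S /D /GRing.scale /= [x * t]mulrC; ring.
have dS : is_derive x 1 (S t th) (t * cos (x * t + th)).
  rewrite (_ : S t th = fun u => sin (u * t + th)); last first.
    by apply/funext => u; rewrite /S mulrC.
  exact: is_derive_sin_affine.
have dp := normal_pdf_is_derive x.
exact: is_deriveM.
Qed.

(** Integration by parts: [x pdf x] is [- s^2] times the derivative of [pdf],
    so the integral of a total derivative over [[-n, n]] vanishes in the limit. *)
Lemma normal_stein t th : \int[mu]_x (D t th x * pdf x) = 0.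
Proof.
pose f x := D t th x * pdf x; pose F x := S t th x * pdf x.
have cf : continuous f.
  by move=> x; apply: cvgM; [exact: continuous_stein | exact: continuous_normal_pdf].
have cF : continuous F.
  move=> x; apply: differentiable_continuous; apply/derivable1_diffP.
  by have [] := stein_is_derive t th x.
have FTC n : (\int[mu]_(x in `[(- n.+1%:R)%R, n.+1%:R]) (f x)%:E = (F n.+1%:R - F (- n.+1%:R))%:E)%E.
  rewrite EFinB; apply: continuous_FTC2.
  - by rewrite (@lt_trans _ _ 0) // oppr_lt0.
  - exact: continuous_subspaceT.
  - split; first by move=> x _; have [] := stein_is_derive t th x.
      exact/cvg_at_right_filter/cF.
    exact/cvg_at_left_filter/cF.
  - by move=> x _; rewrite derive1E; have [_ ->] := stein_is_derive t th x.
have [FpN FmN] : (F n%:R @[n --> \oo] --> (0 : R) /\ F (- n%:R) @[n --> \oo] --> (0 : R)).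
  by apply: cvg_normal_pdf0 => x; exact: sin_max.
have lim0 : F n.+1%:R - F (- n.+1%:R) @[n --> \oo] --> (0 : R).
  rewrite -[X in _ --> X](subrr 0); apply: cvgB.
    by have := FpN; rewrite -cvg_shiftS.
  by have := FmN; rewrite -cvg_shiftS.
pose fn n : R -> \bar R := (EFin \o f) \_ `[(- n.+1%:R)%R, n.+1%:R].
have mf : measurable_fun setT (EFin \o f).
  by apply/measurable_EFinP; exact: continuous_measurable_fun.
have [|||||_ _] := @dominated_convergence _ _ _ mu setT measurableT fn (EFin \o f) (abse \o (EFin \o f)).
- by move=> n; apply: (measurable_restrictT (EFin \o f) _).1 => //; exact: measurable_funTS mf.
- exact: mf.
- apply: aeW => x _; apply: cvg_near_cst.
  near=> n; rewrite /fn patchE mem_set //= in_itv /= -ler_norml.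
  near: n; exists (Num.truncn `|x|) => // n /= xn.
  by apply: ltW; apply: lt_le_trans (truncnS_gt _) _; rewrite ler_nat ltnS.
- exact: integrable_abse (integrable_stein t th).
- apply: aeW => x n _; rewrite /fn patchE; case: ifPn => // _ /=.
  by rewrite normr0 lee_fin.
move=> lim1.
have lim2 : (F n.+1%:R - F (- n.+1%:R))%:E @[n --> \oo] --> (\int[mu]_x (f x)%:E)%E.
  rewrite (_ : (fun n => _) = [sequence (\int[mu]_x fn n x)%E]_n) //.
  by apply/funext => n; rewrite -FTC integral_mkcond.
have lim3 : (F n.+1%:R - F (- n.+1%:R))%:E @[n --> \oo] --> 0%:E.
  by apply: cvg_EFin => //; exact: nearW.
by rewrite /Rintegral (cvg_unique _ lim2 lim3).
Unshelve. all: end_near. Qed.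

Let y th t := \int[mu]_x (cos (t * x + th) * pdf x).

Let integrable_cos th t : mu.-integrable setT (EFin \o (fun x => cos (t * x + th) * pdf x)).
Proof.
apply: (@integrable_mul_normal_pdf _ 1).
  exact: continuous_affine_comp (@continuous_cos R).
by move=> x; rewrite mul1r; apply: le_trans (cos_max _) _; rewrite lerDl.
Qed.

Lemma normal_cos_is_derive th (t : R) :
  is_derive t 1 (y th) (\int[mu]_x (- (x * sin (t * x + th)) * pdf x)).
Proof.
pose g (t x : R) := cos (t * x + th) * pdf x.
have dg (u x : R) : is_derive u 1 (g ^~ x) (- (x * sin (u * x + th)) * pdf x).
  rewrite mulrC (_ : g ^~ x = pdf x *: (fun u : R => cos (u * x + th))); last first.
    by apply/funext => v; rewrite /g mulrC.
  apply: is_deriveZ; exact: is_derive_cos_affine.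
have tI : `]t - 1, t + 1[%classic t by rewrite /= in_itv /=; lra.
pose G x : R := `|x| * pdf x.
have intG : mu.-integrable setT (EFin \o G).
  apply: (@integrable_mul_normal_pdf _ 1); first exact: norm_continuous.
  by move=> x; rewrite normr_id mul1r lerDr.
have G0 x : 0 <= G x by rewrite mulr_ge0 ?normal_pdf_ge0.
have dG u x : `]t - 1, t + 1[%classic u -> [set: R] x -> `|partial1of2 g u x| <= G x.
  move=> _ _; rewrite /partial1of2 derive1E; have [_ ->] := dg u x.
  rewrite normrM normrN normrM [X in _ * X]ger0_norm ?normal_pdf_ge0 //.
  by rewrite ler_wpM2r ?normal_pdf_ge0 // ler_piMr ?sin_max.
have der u x : `]t - 1, t + 1[%classic u -> [set: R] x -> derivable (g ^~ x) u 1.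
  by move=> _ _; have [] := dg u x.
have ig u : `]t - 1, t + 1[%classic u -> mu.-integrable setT (EFin \o g u).
  by move=> _; exact: integrable_cos.
apply: DeriveDef.
  exact: (derivable_under_integral measurableT tI ig der G0 intG dG).
rewrite -derive1E (differentiation_under_integral measurableT tI ig der G0 intG dG).
apply: eq_Rintegral => x _.
by rewrite /partial1of2 derive1E; have [_ ->] := dg t x.
Qed.

(** [normal_stein] turns the derivative of the characteristic function into
    [- s^2 t] times that function, an exact instance of [gaussian_ode]. *)
Lemma normal_cos t th :
  \int[nu]_x cos (t * x + th) = cos th * expR (- (s ^+ 2 * t ^+ 2 / 2)).
Proof.
rewrite integral_normal_density; last first.
  apply: (@integrable_continuous_bounded _ _ _ 1).
    exact: continuous_affine_comp (@continuous_cos R).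
  by move=> x; exact: cos_max.
have y0 : y th 0 = cos th.
  rewrite /y; under eq_Rintegral do rewrite mul0r add0r.
  rewrite RintegralZl //; last exact: integrable_normal_pdf.
  by rewrite /Rintegral integral_normal_pdf mulr1.
apply/eqP; rewrite -subr_eq0 -normr_le0 -y0.
have := @gaussian_ode R (y th) (fun t => \int[mu]_x (- (x * sin (t * x + th)) * pdf x))
  (s ^+ 2) 0 (sqr_ge0 s) (lexx 0) (normal_cos_is_derive th) _ t.
rewrite mul0r; apply => {}t; rewrite mul0r normr_le0.
rewrite -[X in _ + X]RintegralZl //.
have sq : s ^+ 2 != 0 by rewrite expf_neq0.
have E x : s ^+ 2 * (D t th x * pdf x) =
    s ^+ 2 * t * (cos (t * x + th) * pdf x) + - (x * sin (t * x + th)) * pdf x.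
  by rewrite /D; field.
rewrite addrC -RintegralD //; last 2 first.
- exact: (integrableZl measurableT (s ^+ 2 * t) (integrable_cos th t)).
- apply: (@integrable_mul_normal_pdf _ 1).
    move=> x; apply: cvgN; apply: cvgM; first exact: cvg_id.
    exact: (continuous_affine_comp (g := @sin R) (@continuous_sin R)).
  move=> x; rewrite normrN normrM mul1r; apply: le_trans (_ : `|x| <= _); last by rewrite lerDr.
  by rewrite ler_piMr ?sin_max.
under eq_Rintegral do rewrite -E.
rewrite RintegralZl //; last exact: integrable_stein.
by rewrite normal_stein mulr0.
Qed.

End normal_characteristic_function.

(** * Galton--Watson expectations and the limit variance *)
Section galton_watson.
Variables (R : realType) (p : nat -> R).
Local Notation pi_ T := (letter_prod p (word T)).

Lemma gw_probE T : gw_prob p T = pi_ T.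
Proof.
rewrite /gw_prob (fsbigTE [fset a in undup (word T)]%fset); last first.
  move=> a; rewrite !inE mem_undup => aT.
  by rewrite tree_stat_word (count_memPn aT) expr0.
rewrite /letter_prod [LHS](perm_big (undup (word T))) /=.
  rewrite -[RHS]prodr_undup_exp_count.
  by apply: eq_bigr => a _; rewrite tree_stat_word.
by apply: uniq_perm; rewrite ?fset_uniq ?undup_uniq // => a; rewrite !inE.
Qed.

Lemma esum_finite_support (supp : seq plane_tree) (a : plane_tree -> R) :
  uniq supp -> (forall T, 0 <= a T) -> (forall T, T \notin supp -> a T = 0) ->
  (\esum_(T in [set: plane_tree]) (a T)%:E = (\sum_(T <- supp) a T)%:E)%E.
Proof.
move=> supp_uniq a0 aS.
transitivity (\esum_(T in [set` supp]) (a T)%:E)%E.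
  rewrite [RHS]esum_mkcond; apply: eq_esum => T _; case: ifPn => //.
  by rewrite notin_setE /= => /negP/aS->.
rewrite esum_fset; [|exact: finite_seq|by move=> T _; rewrite lee_fin].
by rewrite -fsbig_seq // sumEFin.
Qed.

Lemma gw_expect_finite_support (supp : seq plane_tree) (g : plane_tree -> R) :
  uniq supp -> (forall T, T \notin supp -> g T = 0) ->
  gw_expect p g = (\sum_(T <- supp) g T * pi_ T)%:E.
Proof.
move=> supp_uniq gS; rewrite /gw_expect.
rewrite !(esum_finite_support supp_uniq); last 4 first.
- by move=> T; rewrite le_max lexx orbT.
- by move=> T /gS->; rewrite mul0r oppr0 maxxx.
- by move=> T; rewrite le_max lexx orbT.
- by move=> T /gS->; rewrite mul0r maxxx.
rewrite -EFinB -sumrB; congr (_%:E); apply: eq_bigr => T _.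
rewrite gw_probE; case: (leP 0 (g T * _)) => gT.
  by rewrite max_r ?subr0 // oppr_le0.
by rewrite max_l ?sub0r ?opprK // oppr_ge0 ltW.
Qed.

Lemma eseries_finite_support (a : nat -> R) B :
  (forall i, (B <= i)%N -> a i = 0) ->
  (\sum_(0 <= i <oo) (a i)%:E = (\sum_(i < B) a i)%:E)%E.
Proof.
move=> aB; apply: lim_near_cst => //; near=> n.
rewrite sumEFin (@big_cat_nat _ _ _ B) //=; last by near: n; exact: nbhs_infty_ge.
rewrite [X in _ + X]big_nat_cond [X in _ + X]big1 ?addr0 ?big_mkord //.
by move=> i /andP[/andP[Bi _] _]; exact: aB.
Unshelve. all: end_near. Qed.

Variables (f : plane_tree -> R) (supp : seq plane_tree).
Hypotheses (supp_uniq : uniq supp) (f_supp : forall T, T \notin supp -> f T = 0).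

Definition letter_bound : nat := \max_(T <- supp) \max_(a <- word T) a.+1.

Lemma letter_boundP T a : T \in supp -> a \in word T -> (a < letter_bound)%N.
Proof.
move=> Ts aT; apply: (@leq_trans (\max_(b <- word T) b.+1)).
  by rewrite (big_rem a) //= leq_max leqnn.
by rewrite /letter_bound (big_rem T) //= leq_max leqnn.
Qed.

Definition gamma_value : R :=
  2 * \sum_(T <- supp) f T * additive_functional f T * pi_ T
  - \sum_(T <- supp) f T ^+ 2 * pi_ T
  + (\sum_(T <- supp) f T * ((tree_size T)%:R - 1) * pi_ T) ^+ 2
  - \sum_(i < letter_bound)
      (\sum_(T <- supp) f T * (tree_stat T i)%:R * pi_ T) ^+ 2 / p i.

Hypothesis p_ge0 : forall i, 0 <= p i.

Lemma gw_gammaE : gw_gamma p f = gamma_value%:E.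
Proof.
rewrite /gw_gamma.
rewrite !(gw_expect_finite_support supp_uniq); last 3 first.
- by move=> T /f_supp->; rewrite mul0r.
- by move=> T /f_supp->; rewrite expr0n.
- by move=> T /f_supp->; rewrite mul0r.
have E i : (if (0 < p i)%R
        then ((p i)^-1)%:E *
             gw_expect p (fun T => f T * (tree_stat T i)%:R)%R ^+ 2
        else 0)%E =
    ((\sum_(T <- supp) f T * (tree_stat T i)%:R * pi_ T) ^+ 2 / p i)%:E.
  rewrite (gw_expect_finite_support supp_uniq); last first.
    by move=> T /f_supp->; rewrite mul0r.
  case: ifPn => [_|]; first by rewrite -EFin_expe -EFinM mulrC.
  by rewrite -leNgt => pi0; rewrite (le_anti (_ : p i <= 0 <= p i)%R) ?pi0 ?p_ge0 // invr0 mulr0.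
under eq_eseriesr do rewrite E.
rewrite (@eseries_finite_support _ letter_bound) // => i iB.
rewrite big_seq big1 ?expr0n ?mul0r // => T Ts.
rewrite tree_stat_word (count_memPn _) ?mulr0 ?mul0r //.
by apply: contraTN iB => /(letter_boundP Ts); rewrite -ltnNge.
Qed.

Definition limit_variance : R :=
  \sum_(T <- supp) \sum_(T' <- supp) f T * f T' *
    ((count_mem T' (subtrees T))%:R * pi_ T +
     ((count_mem T (subtrees T'))%:R - (T == T')%:R) * pi_ T' +
     (1 - (size (word T))%:R - (size (word T'))%:R) *
       letter_prod p (word T ++ word T') +
     letter_corr p (word T') (word T)).

Lemma sum_supp_count T :
  \sum_(T' <- supp) f T' * (count_mem T' (subtrees T))%:R = additive_functional f T.
Proof.
rewrite additive_functional_subtrees.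
under eq_bigr do rewrite -sum1_count natr_sum mulr_sumr big_mkcond.
rewrite exchange_big /=; apply: eq_bigr => S _.
under eq_bigr do rewrite mulr1 /=.
have [Ss|/[dup] Ss /f_supp->] := boolP (S \in supp).
  rewrite (bigD1_seq S) //= eqxx big1 ?addr0 // => T'.
  by rewrite eq_sym => /negbTE->.
rewrite big_seq big1 // => T' T's; case: eqVneq => // e.
by rewrite e T's in Ss.
Qed.

Lemma sum_count_div T T' : T \in supp -> T' \in supp ->
  \sum_(a <- word T) (count_mem a (word T'))%:R / p a =
  \sum_(i < letter_bound) (tree_stat T i)%:R * (tree_stat T' i)%:R / p i.
Proof.
move=> Ts T's; rewrite (big_seq_cond).
under [RHS]eq_bigr do rewrite !tree_stat_word -mulrA -sum1_count natr_sum mulr_suml.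
under [RHS]eq_bigr do rewrite big_mkcond /=.
rewrite exchange_big /= -big_seq_cond big_seq [RHS]big_seq.
apply: eq_bigr => a aT.
rewrite (bigD1 (Ordinal (letter_boundP Ts aT))) //= eqxx mul1r big1 ?addr0 //.
move=> i; rewrite -val_eqE /= eq_sym => /negbTE-> //.
Qed.

(** Nested pairs give [2 f F - f^2].  The remaining coefficient of
    [f T * f T'] factors, since [|T| |T'| - |T| - |T'| + 1] is the product of
    [|T| - 1] and [|T'| - 1], and the sum over letters is the one with the
    factors [1 / p i]. *)
Lemma limit_varianceE : limit_variance = gamma_value.
Proof.
pose A : R := \sum_(T <- supp) f T * additive_functional f T * pi_ T.
pose Q : R := \sum_(T <- supp) f T ^+ 2 * pi_ T.
pose S : R := \sum_(T <- supp) f T * ((tree_size T)%:R - 1) * pi_ T.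
pose C i : R := \sum_(T <- supp) f T * (tree_stat T i)%:R * pi_ T.
have term T T' : T \in supp -> T' \in supp -> f T * f T' *
    ((count_mem T' (subtrees T))%:R * pi_ T +
     ((count_mem T (subtrees T'))%:R - (T == T')%:R) * pi_ T' +
     (1 - (size (word T))%:R - (size (word T'))%:R) *
       letter_prod p (word T ++ word T') +
     letter_corr p (word T') (word T)) =
   f T * pi_ T * (f T' * (count_mem T' (subtrees T))%:R)
   + f T' * pi_ T' * (f T * (count_mem T (subtrees T'))%:R)
   - f T * f T' * (T == T')%:R * pi_ T'
   + f T * ((tree_size T)%:R - 1) * pi_ T * (f T' * ((tree_size T')%:R - 1) * pi_ T')
   - \sum_(i < letter_bound) f T * (tree_stat T i)%:R * pi_ T *
       (f T' * (tree_stat T' i)%:R * pi_ T') / p i.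
  move=> Ts T's; rewrite /letter_corr sum_count_div // !tree_size_word.
  have -> : letter_prod p (word T ++ word T') = pi_ T * pi_ T' by rewrite /letter_prod big_cat.
  have -> : \sum_(i < letter_bound) f T * (tree_stat T i)%:R * pi_ T *
       (f T' * (tree_stat T' i)%:R * pi_ T') / p i =
     f T * f T' * pi_ T * pi_ T' *
     \sum_(i < letter_bound) (tree_stat T i)%:R * (tree_stat T' i)%:R / p i.
    by rewrite mulr_sumr; apply: eq_bigr => i _; ring.
  ring.
have -> : limit_variance = A + A - Q + S * S - \sum_(i < letter_bound) C i * C i / p i.
  rewrite /limit_variance big_seq.
  under eq_bigr => T Ts do rewrite big_seq (eq_bigr _ (fun T' T's => term T T' Ts T's)) -big_seq.
  rewrite -big_seq.
  under eq_bigr do rewrite !(sumrB, big_split) /=.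
  rewrite !(sumrB, big_split) /=; congr (_ + _ - _ + _ - _).
  - by apply: eq_bigr => T _; rewrite -mulr_sumr sum_supp_count; ring.
  - rewrite exchange_big; apply: eq_bigr => T _; rewrite -mulr_sumr sum_supp_count; ring.
  - rewrite big_seq [RHS]big_seq; apply: eq_bigr => T Ts.
    rewrite (bigD1_seq T) //= eqxx mulr1 -expr2 big1 ?addr0 // => T'.
    by rewrite eq_sym => /negbTE->; rewrite mulr0 mul0r.
  - by rewrite /S mulr_suml; apply: eq_bigr => T _; rewrite mulr_sumr.
  - under eq_bigr do rewrite exchange_big /=.
    rewrite exchange_big /=; apply: eq_bigr => i _.
    rewrite /C mulr_suml mulr_suml; apply: eq_bigr => T _.
    by rewrite mulr_sumr mulr_suml.
rewrite /gamma_value -/A -/Q -/S; under [X in _ = _ - X]eq_bigr do rewrite expr2.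
by rewrite -/C; ring.
Qed.

End galton_watson.

(** * Expectations over uniform trees *)
Section uniform_trees.
Variables (R : realType) (d : measure_display) (Omega : measurableType d).
Variables (P : probability Omega R) (D : set plane_tree) (X : {RV P >-> plane_tree}).
Hypothesis X_unif : uniform_on D X.
Local Notation S := (fset_set D).

(** The quotient [0 / 0] is [0], which is not a total mass. *)
Lemma uniform_card_gt0 : (0 < #|` S|)%N.
Proof.
have := X_unif setT; rewrite /distribution /pushforward preimage_setT probability_setT setTI.
by case: #|` S| => // /esym/eqP; rewrite mul0r eqe eq_sym oner_eq0.
Qed.

Lemma uniform_finite : finite_set D.
Proof.
apply: contrapT => Dinf; have := uniform_card_gt0.
by rewrite /fset_set; case: pselect.
Qed.

Lemma measurable_tree_fun (H : plane_tree -> R) : measurable_fun setT H.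
Proof. by move=> _ B _; exact: I. Qed.

Lemma uniform_atom T : T \in D -> P (X @^-1` [set T]) = (#|` S|%:R^-1)%:E.
Proof.
move=> TD; have := X_unif [set T]; rewrite /distribution /pushforward => ->.
have -> : [set T] `&` D = [set T].
  by apply/seteqP; split => [x []|x ->] //=; split => //; exact: set_mem.
by rewrite fset_set1 cardfs1 mul1r.
Qed.

Lemma expectation_uniform (H : plane_tree -> R) :
  ('E_P[H \o X] = ((\sum_(T <- S) H T) / #|` S|%:R)%:E)%E.
Proof.
have Dfin := uniform_finite.
have mA T : measurable (X @^-1` [set T]).
  by rewrite -[X in measurable X]setTI; exact: measurable_funPT.
rewrite expectation.unlock.
transitivity (\int[P]_w \sum_(T <- S) ((H T)%:E * (\1_(X @^-1` [set T]) w)%:E))%E.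
  apply: ae_eq_integral => //.
  - apply/measurable_EFinP/measurableT_comp; first exact: measurable_tree_fun.
    exact: measurable_funPT.
  - apply: emeasurable_sum => T; apply: measurable_funeM.
    exact/measurable_EFinP/measurable_indic.
  - exists (X @^-1` (~` D)); split.
    + by rewrite -[X in measurable X]setTI; exact: measurable_funPT.
    + apply: (etrans (X_unif (~` D))).
      by rewrite setICl fset_set0 cardfs0 mul0r.
    + move=> w /=; apply: contra_not => XD _ /=.
      have XS : X w \in S by rewrite in_fset_set // mem_set.
      rewrite (bigD1_seq (X w)) ?fset_uniq //=.
      rewrite indicE mem_set // mule1 big1 ?adde0 // => T TX.
      rewrite indicE memNset ?mule0 //= => XT.
      by rewrite XT eqxx in TX.
rewrite integral_sum //; last first.
  move=> T; apply: integrableZl => //; exact: integrable_indic.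
rewrite mulr_suml -sumEFin big_seq [RHS]big_seq; apply: eq_bigr => T.
rewrite in_fset_set // => TD.
rewrite integralZl //; last exact: integrable_indic.
rewrite EFinM; congr (_ * _)%E; rewrite integral_indic // setIT.
exact: uniform_atom.
Qed.

End uniform_trees.

Lemma sum_count_undup (w : seq nat) : (\sum_(a <- undup w) count_mem a w = size w)%N.
Proof.
under eq_bigr do rewrite -sum1_count big_mkcond /=.
rewrite exchange_big /= -sum1_size big_seq [RHS]big_seq; apply: eq_bigr => b bw.
rewrite (bigD1_seq b) ?mem_undup ?undup_uniq //= eqxx big1 // => a.
by rewrite eq_sym => /negbTE->.
Qed.

Lemma stat_size_word (n : nat -> nat) T : trees_of n T -> stat_size n = size (word T).
Proof.
move=> Tn; have nE i : n i = count_mem i (word T) by rewrite -Tn tree_stat_word.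
rewrite /stat_size (fsbigTE [fset a in undup (word T)]%fset); last first.
  by move=> a; rewrite !inE mem_undup nE => /count_memPn.
rewrite (perm_big (undup (word T))) /=.
  by under eq_bigr do rewrite nE; exact: sum_count_undup.
by apply: uniq_perm; rewrite ?fset_uniq ?undup_uniq // => a; rewrite !inE.
Qed.

Lemma trees_of_perm (n : nat -> nat) T T' : trees_of n T ->
  trees_of n T' <-> perm_eq (word T') (word T).
Proof.
move=> Tn; split=> [T'n|T'T] /=.
  by apply/allP => i _ /=; rewrite -!tree_stat_word Tn T'n.
by move=> i; rewrite -Tn !tree_stat_word; exact/seq.permP.
Qed.

Lemma sumn_word T : (sumn (word T) + 1 = size (word T))%N.
Proof.
have : parses 1 (word T) by apply/parses1P; exists T.
by rewrite parsesE => /andP[_ /eqP].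
Qed.

(** All rotations of the word of a tree give the same value of [H], so a uniform
    tree may be replaced by a uniform arrangement of its outdegrees. *)
Lemma expectation_trees (R : realType) (d : measure_display) (Omega : measurableType d)
    (P : probability Omega R) (n : nat -> nat) (X : {RV P >-> plane_tree}) T
    (H : seq nat -> R) :
  uniform_on (trees_of n) X -> trees_of n T -> (forall i x, H (rot i x) = H x) ->
  ('E_P[(fun T' => H (word T')) \o X] =
   (avg (fun s => H (arrangement (in_tuple (word T)) s)))%:E)%E.
Proof.
move=> X_unif Tn H_rot; rewrite (expectation_uniform X_unif); congr (_%:E).
have Dfin := uniform_finite X_unif.
rewrite (@avg_trees _ (in_tuple (word T)) _ (fset_set (trees_of n))) //.
- exact: fset_uniq.
- move=> T'; rewrite in_fset_set //; apply/idP/idP => [/set_mem|] T'P.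
    exact/(trees_of_perm _ Tn).
  by apply/mem_set/(trees_of_perm _ Tn).
- exact: sumn_word.
Qed.

Lemma trees_of_inhabited (R : realType) (d : measure_display) (Omega : measurableType d)
    (P : probability Omega R) (D : set plane_tree) (X : {RV P >-> plane_tree}) :
  uniform_on D X -> exists T, D T.
Proof.
move=> X_unif; have := uniform_card_gt0 X_unif.
case: (fset_set D =P fset0)%fset => [->|/eqP/fset0Pn[T]]; first by rewrite cardfs0.
rewrite in_fset_set; last exact: uniform_finite X_unif.
by move=> /set_mem DT; exists T.
Qed.

(** * Limits along a sequence of arrangements *)
Lemma centered_normal_cos (R : realType) (gamma : R) (t th : R) : 0 <= gamma ->
  \int[centered_normal gamma]_x cos (t * x + th) =
  cos th * expR (- (gamma * t ^+ 2 / 2)).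
Proof.
move=> gamma0; rewrite /centered_normal; have [->|gamma_neq0] := eqVneq gamma 0.
  rewrite !mul0r oppr0 expR0 mulr1 /Rintegral integral_dirac //.
    by rewrite diracT mul1e mulr0 add0r.
  apply/measurable_EFinP; apply: continuous_measurable_fun.
  exact: continuous_affine_comp (@continuous_cos R).
have s0 : Num.sqrt gamma != 0.
  by rewrite gt_eqF // sqrtr_gt0 lt_neqAle eq_sym gamma_neq0.
by apply: etrans (normal_cos s0 t th) _; rewrite sqr_sqrtr.
Qed.

Lemma cvg_sum_seq (R : realType) (I : Type) (r : seq I) (F : I -> nat -> R) (l : I -> R) :
  (forall i, F i k @[k --> \oo] --> l i) ->
  \sum_(i <- r) F i k @[k --> \oo] --> \sum_(i <- r) l i.
Proof.
move=> Fl; elim: r => [|i r IH].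
  by rewrite big_nil; under eq_fun do rewrite big_nil; exact: cvg_cst.
rewrite big_cons; under eq_fun do rewrite big_cons.
by apply: cvgD.
Qed.

Section arrangement_limits.
Variables (R : realType) (p : nat -> R) (N : nat -> nat).
Variables (y : forall k, (N k).-tuple nat).
Arguments y : clear implicits.
Hypotheses (N_infty : N k @[k --> \oo] --> \oo)
  (y_freq : forall a, freq R (y k) a @[k --> \oo] --> p a).
Variables (f : plane_tree -> R) (supp : seq plane_tree).
Hypotheses (supp_uniq : uniq supp) (f_supp : forall T, T \notin supp -> f T = 0).

Definition word_bound : nat := \max_(T <- supp) size (word T).

Lemma word_boundP T : T \in supp -> (size (word T) <= word_bound)%N.
Proof. by move=> Ts; rewrite /word_bound (big_rem T) //= leq_max leqnn. Qed.

Local Notation U k := (fun s => rot_sum (pattern_value supp f) (arrangement (y k) s)).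
Local Notation W k := (normalized_sum (site_value (y k) f supp)).

Let near_large m : \forall k \near \oo, (m < N k)%N.
Proof. exact: (N_infty (nbhs_infty_gt m)). Qed.

Let cvg_invN : (N k)%:R^-1 @[k --> \oo] --> (0 : R).
Proof.
apply/cvgrPdist_le => e e0; near=> k.
have Nk : (Num.truncn e^-1 < N k)%N by near: k; exact: near_large.
rewrite sub0r normrN ger0_norm ?invr_ge0 // -[leRHS]invrK lef_pV2 ?posrE ?invr_gt0 //.
  by apply/ltW/(lt_le_trans (truncnS_gt _)); rewrite ler_nat.
by rewrite ltr0n (leq_ltn_trans _ Nk).
Unshelve. all: end_near. Qed.

Lemma cvg_mean : avg (U k) / (N k)%:R @[k --> \oo] -->
  \sum_(T <- supp) f T * letter_prod p (word T).
Proof.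
apply: (@cvg_trans _ ((fun k => \sum_(T <- supp) f T *
    draw_prob (freq R (y k)) (N k)%:R^-1 (word T)) @ \oo)).
  apply: near_eq_cvg; near=> k.
  have Nk : (word_bound < N k)%N by near: k; exact: near_large.
  rewrite (avg_rot_sum (y k) f word_boundP (ltnW Nk)).
  by rewrite mulrC mulKf // pnatr_eq0 -lt0n (leq_ltn_trans _ Nk).
apply: cvg_sum_seq => T; apply: cvgM; first exact: cvg_cst.
exact: (cvg_draw_prob y_freq cvg_invN).
Unshelve. all: end_near. Qed.

Lemma cvg_variance : avg (fun s => W k s ^+ 2) @[k --> \oo] --> gamma_value p f supp.
Proof.
rewrite -(limit_varianceE p supp_uniq f_supp).
apply: (@cvg_trans _ ((fun k => pattern_variance f supp (freq R (y k)) (N k)%:R^-1) @ \oo)).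
  apply: near_eq_cvg; near=> k.
  have Nk : (word_bound + word_bound < N k)%N by near: k; exact: near_large.
  rewrite (avg_normalized_sqrE (y k) f word_boundP _ Nk) //.
  exact: leq_ltn_trans Nk.
apply: cvg_sum_seq => T; apply: cvg_sum_seq => T'; apply: cvgM; first exact: cvg_cst.
have cq w := @cvg_draw_prob _ p _ _ y_freq cvg_invN w.
apply: cvgD; last exact: (cvg_draw_defect y_freq cvg_invN).
apply: cvgD; last by apply: cvgM; [exact: cvg_cst | exact: cq].
apply: cvgD; apply: cvgM; by [exact: cvg_cst | exact: cq].
Unshelve. all: end_near. Qed.

(** A limit of variances. *)
Lemma gamma_value_ge0 : 0 <= gamma_value p f supp.
Proof.
apply: (@closed_cvg _ _ \oo _ (fun k => avg (fun s => W k s ^+ 2)) [set x | 0 <= x]).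
- exact: closed_ge.
- by near=> k => /=; apply: avg_ge0 => s; exact: sqr_ge0.
- exact: cvg_variance.
Unshelve. all: end_near. Qed.

Lemma cvg_char_fun t th : avg (fun s => cos (t * W k s + th)) @[k --> \oo] -->
  \int[centered_normal (gamma_value p f supp)]_x cos (t * x + th).
Proof.
rewrite centered_normal_cos ?gamma_value_ge0 //.
pose v k := avg (fun s => W k s ^+ 2).
have c1 : cos th * expR (- (v k * t ^+ 2 / 2)) @[k --> \oo] -->
    cos th * expR (- (gamma_value p f supp * t ^+ 2 / 2)).
  apply: cvgM; first exact: cvg_cst.
  apply: (@cvg_comp _ _ _ (fun k => - (v k * t ^+ 2 / 2)) expR _ (nbhs (- (gamma_value p f supp * t ^+ 2 / 2)))); last exact: continuous_expR.
  apply: cvgN; apply: cvgM; last exact: cvg_cst.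
  by apply: cvgM; [exact: cvg_variance | exact: cvg_cst].
pose C := stein_const word_bound (value_bound f supp) * `|t| ^+ 3.
have C0 : C / Num.sqrt (N k)%:R @[k --> \oo] --> (0 : R).
  rewrite -(mulr0 C); apply: cvgM; first exact: cvg_cst.
  have : Num.sqrt ((N k)%:R^-1) @[k --> \oo] --> Num.sqrt (0 : R).
    apply: (@cvg_comp _ _ _ (fun k => (N k)%:R^-1 : R) Num.sqrt _ (nbhs 0)); first exact: cvg_invN.
    exact: sqrt_continuous.
  by rewrite sqrtr0; under eq_fun do rewrite sqrtrV ?ler0n //.
apply/cvgrPdist_le => e e0.
have e2 : 0 < e / 2 by rewrite divr_gt0.
move/cvgrPdist_le : c1 => /(_ _ e2) c1; move/cvgrPdist_le : C0 => /(_ _ e2) C0.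
near=> k.
have Nk : (0 < N k)%N by near: k; exact: near_large.
have := @avg_cos_estimate R 'I_(N k) (site_value (y k) f supp) (window word_bound)
  word_bound (value_bound f supp) (fun i => site_value_depends (y k) f word_boundP (i := i))
  (@card_window (N k) word_bound) (@card_window_mem (N k) word_bound)
  (site_value_le (y k) f supp).
rewrite card_ord => /(_ Nk t th) est.
rewrite (_ : _ - avg _ = (cos th * expR (- (gamma_value p f supp * t ^+ 2 / 2)) -
   cos th * expR (- (v k * t ^+ 2 / 2))) - (avg (fun s => cos (t * W k s + th)) -
   cos th * expR (- (v k * t ^+ 2 / 2)))); last by ring.
apply: le_trans (ler_normB _ _) _; rewrite [e]splitr; apply: lerD.
  by near: k.
apply: le_trans est _; rewrite mulrAC -/C.
apply: le_trans (ler_norm _) _; rewrite -normrN -sub0r.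
by near: k.
Unshelve. all: end_near. Qed.

Lemma cvg_normalized_sum (g : R -> R) (M : R) : continuous g -> (forall x, `|g x| <= M) ->
  avg (g \o W k) @[k --> \oo] --> \int[centered_normal (gamma_value p f supp)]_x g x.
Proof.
move=> cg gM.
apply: (@cvg_avg_bounded_continuous _ _ (fun k => {perm 'I_(N k)}) (fun k s => W k s)
  (gamma_value p f supp + 1) _ _ cvg_char_fun g M cg gM).
  by move=> k; exact: card_perm_gt0.
have /cvgrPdist_le/(_ 1 ltr01) := cvg_variance.
apply: filterS => k; rewrite distrC => h; rewrite -lerBlDl.
by apply: le_trans h; exact: ler_norm.
Qed.

End arrangement_limits.

(** * The central limit theorem *)
Lemma littleo_of_cvg (R : realType) (a : nat -> R) (l : R) (N : nat -> nat) :
  (\forall k \near \oo, (0 < N k)%N) -> a k / (N k)%:R @[k --> \oo] --> l ->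
  (fun k => a k - (N k)%:R * l) =o_\oo (fun k => (N k)%:R : R).
Proof.
move=> N_gt0 al; apply/eqoP => e e0.
move/cvgrPdist_le : al => /(_ e e0) al; near=> k.
have Nk : (0 < N k)%N by near: k.
have ak : `|l - a k / (N k)%:R| <= e by near: k.
rewrite -(_ : (N k)%:R * (a k / (N k)%:R - l) = a k - (N k)%:R * l); last first.
  by field; rewrite pnatr_eq0 -lt0n.
by rewrite normrM mulrC distrC ler_wpM2r.
Unshelve. all: end_near. Qed.

Theorem theorem8p1 (R : realType) (n : nat -> nat -> nat) (p : nat -> R)
    (d : nat -> measure_display) (Omega : forall k, measurableType (d k))
    (P : forall k, probability (Omega k) R)
    (X : forall k, {RV (P k) >-> plane_tree}) (f : plane_tree -> R)
    (n_stat : forall k, degree_statistic (n k))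
    (n_infty : stat_size (n k) @[k --> \oo] --> \oo)
    (p_ge0 : forall i, 0 <= p i)
    (p_sum1 : (\sum_(0 <= i <oo) (p i)%:E = 1)%E)
    (n_cvg : forall i,
      (n k i)%:R / (stat_size (n k))%:R @[k --> \oo] --> p i)
    (X_unif : forall k, uniform_on (trees_of (n k)) (X k))
    (f_supp : finite_set [set T | f T != 0]) :
  (exists2 r : nat -> R,
     r =o_\oo (fun k => (stat_size (n k))%:R : R) &
     forall k, 'E_(P k)[additive_functional f \o X k]%E =
       ((stat_size (n k))%:R%:E * gw_expect p f + (r k)%:E)%E) /\
  (exists2 r : nat -> R,
     r =o_\oo (fun k => (stat_size (n k))%:R : R) &
     forall k, 'V_(P k)[additive_functional f \o X k] =
       ((stat_size (n k))%:R%:E * gw_gamma p f + (r k)%:E)%E) /\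
  (0 <= gw_gamma p f < +oo)%E /\
  cvg_in_distribution P
    (fun k w => (additive_functional f (X k w)
                 - fine 'E_(P k)[additive_functional f \o X k]%E)
                / Num.sqrt (stat_size (n k))%:R)
    (centered_normal (fine (gw_gamma p f))).
Proof.
pose supp : seq plane_tree := fset_set [set T | f T != 0].
have supp_uniq : uniq supp by exact: fset_uniq.
have f0 T : T \notin supp -> f T = 0.
  by rewrite in_fset_set // notin_setE /= => /negP; rewrite negbK => /eqP.
have [T0 T0P] := choice (fun k => trees_of_inhabited (X_unif k)).
pose N k := size (word (T0 k)).
have NE k : stat_size (n k) = N k by exact: stat_size_word (T0P k).
pose y k : (N k).-tuple nat := in_tuple (word (T0 k)).
have N_infty : N k @[k --> \oo] --> \oo by move: n_infty; under eq_fun do rewrite NE.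
have y_freq a : freq R (y k) a @[k --> \oo] --> p a.
  have := n_cvg a; rewrite (_ : (fun k => _) = (fun k => freq R (y k) a)) //.
  by apply/funext => k; rewrite NE /freq /= -tree_stat_word (T0P k).
have N_gt0 k : (0 < N k)%N by exact: size_word_gt0.
pose U k s := rot_sum (pattern_value supp f) (arrangement (y k) s).
pose W k := normalized_sum (site_value (y k) f supp).
have mean k (u : R -> R) :
    ('E_(P k)[fun w => u (additive_functional f (X k w))] = (avg (fun s => u (U k s)))%:E)%E.
  rewrite -(expectation_trees (H := fun x => u (rot_sum (pattern_value supp f) x)) (X_unif k) (T0P k)); last first.
    by move=> i x; rewrite rot_sum_rot.
  congr expectation; apply/funext => w /=.
  by rewrite (additive_functional_rot_sum _ supp_uniq f0).
have EF k : ('E_(P k)[additive_functional f \o X k] = (avg (U k))%:E)%E by exact: mean k id.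
have WE k s : W k s = (U k s - avg (U k)) / Num.sqrt (N k)%:R.
  rewrite /W /normalized_sum card_ord local_sum_site_value.
  by rewrite (eq_avg (local_sum_site_value (y k) f supp)).
have gE : gw_gamma p f = (gamma_value p f supp)%:E by exact: gw_gammaE.
have NR : (fun k => (stat_size (n k))%:R : R) = (fun k => (N k)%:R : R).
  by apply/funext => k; rewrite NE.
rewrite gE /=; split; [|split; [|split]].
- exists (fun k => avg (U k) - (N k)%:R * \sum_(T <- supp) f T * letter_prod p (word T)).
    rewrite NR.
    apply: littleo_of_cvg; first exact: nearW.
    exact: (cvg_mean N_infty y_freq).
  move=> k; rewrite EF NE (gw_expect_finite_support p supp_uniq f0) -EFinM -EFinD.
  by rewrite addrC subrK.
- pose v k := avg (fun s => W k s ^+ 2).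
  exists (fun k => (N k)%:R * v k - (N k)%:R * gamma_value p f supp).
    rewrite NR.
    apply: littleo_of_cvg; first exact: nearW.
    rewrite (_ : (fun k => _) = v); first exact: (cvg_variance N_infty y_freq supp_uniq f0).
    by apply/funext => k; rewrite mulrC mulKf // pnatr_eq0 -lt0n.
  move=> k; rewrite NE -EFinM -EFinD addrC subrK /variance covariance.unlock EF /=.
  rewrite (mean k (fun x => (x - avg (U k)) * (x - avg (U k)))); congr (_%:E).
  rewrite /v -avgZ; apply: eq_avg => s; rewrite WE exprMn exprVn sqr_sqrtr //.
  by field; rewrite pnatr_eq0 -lt0n.
- by rewrite lee_fin (gamma_value_ge0 N_infty y_freq supp_uniq f0) ltry.
- move=> g cg [M gM].
  have lim := cvg_normalized_sum N_infty y_freq supp_uniq f0 cg gM.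
  rewrite (_ : (fun k => _) = fun k => (avg (g \o W k))%:E); last first.
    apply/funext => k; rewrite EF NE /=.
    rewrite (mean k (fun x => g ((x - avg (U k)) / Num.sqrt (N k)%:R))); congr (_%:E).
    by apply: eq_avg => s; rewrite /= WE.
  rewrite -[X in _ --> X]fineK; last first.
    apply: integrable_fin_num => //; exact: integrable_continuous_bounded cg gM.
  by apply: cvg_EFin => //; exact: nearW.
Qed.
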